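(* Let $q$ be a prime power, $n\ge 3$ an odd integer, $m:=(q^n+1)/(q+1)$ and $M:=(m-1)/(q^2-q)$. Let $P_1$ and $Q_1$ be the points $(1:-1:0:0)$ and $(1:0:0:1)$ of the Beelen-Montanucci curve $\mathcal{BM}_n$ over $\mathbb{F}_{q^{2n}}$, and let $\tau_{Q_1,P_1}:\mathbb{Z}\to\mathbb{Z}$ be the map $\tau_{Q_1,P_1}(i)=\min\{j\mid (i,j)\in H(Q_1,P_1)\}$. Let $i\in\mathbb{Z}$ and write $i=-k(q^n+1)-\ell m-\beta$ for the unique triple $(k,\ell,\beta)\in\mathbb{Z}^3$ with $0\le\beta<m$ and $0\le\ell<q+1$. Let $\gamma:=\lceil \beta/M\rceil$. Then $$\tau_{Q_1,P_1}(i)=k(q^n+1)+(\gamma+\ell)mq+\beta(q^2-q).$$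
   Context: The Beelen-Montanucci curve $\mathcal{BM}_n$ is (the nonsingular model of) the curve over $\mathbb{F}_{q^{2n}}$ given by the affine equations $$y^{q+1}=x^{q+1}-1,\qquad z^m=y\,\frac{x^{q^2}-x}{x^{q+1}-1},\qquad m=\frac{q^n+1}{q+1}.$$ Its function field is $\mathbb{F}_{q^{2n}}(\mathcal{BM}_n)=\mathbb{F}_{q^{2n}}(x,y,z)$, a cover of the Hermitian curve $\mathcal{H}_q: y^{q+1}=x^{q+1}-1$. Homogeneous coordinates are written $(x:y:z:w)$ on $\mathcal{BM}_n$ and $(x:y:w)$ on $\mathcal{H}_q$, with $w=0$ at infinity. The $\mathbb{F}_{q^2}$-rational points of $\mathcal{H}_q$ are totally ramified in $\mathcal{BM}_n\to\mathcal{H}_q$; $P_1=(1:-1:0:0)$ is the unique point (place) of $\mathcal{BM}_n$ lying over the point at infinity $(1:-1:0)$ of $\mathcal{H}_q$, and $Q_1=(1:0:0:1)$ is the unique point lying over the affine point $(x,y)=(1,0)$ of $\mathcal{H}_q$. For two distinct rational points $Q,P$ of a curve $\mathcal{X}$ over a finite field $\mathbb{F}$, let $\mathcal{R}(Q,P):=\{f\in\mathbb{F}(\mathcal{X})\mid v_R(f)\ge 0 \text{ for all points } R\ne Q,P\}$. The two-point Weierstrass semigroup is $$H(Q,P):=\{(i,j)\in\mathbb{Z}^2\mid \exists f\in\mathcal{R}(Q,P)\setminus\{0\},\ v_Q(f)=-i,\ v_P(f)=-j\}.$$ Here the field is $\mathbb{F}_{q^{2n}}$ and $\mathcal{X}=\mathcal{BM}_n$.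 *)

(* Defs.v *)
From HB Require Import structures.
From mathcomp Require Import all_boot all_order all_algebra.

Set Implicit Arguments.
Unset Strict Implicit.
Unset Printing Implicit Defensive.

Import Order.TTheory GRing.Theory Num.Theory.
Local Open Scope ring_scope.

Section FunctionField.

Variables (K L : fieldType) (iota : {rmorphism K -> L}).

Definition transcendental (x : L) : Prop :=
  forall p : {poly K}, p != 0 -> (map_poly iota p).[x] != 0.

Inductive adjoin3 (x y z : L) : L -> Prop :=
  | adjoin3_cst c : adjoin3 x y z (iota c)
  | adjoin3_x : adjoin3 x y z x
  | adjoin3_y : adjoin3 x y z y
  | adjoin3_z : adjoin3 x y z z
  | adjoin3_sub f g :
      adjoin3 x y z f -> adjoin3 x y z g -> adjoin3 x y z (f - g)
  | adjoin3_div f g :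
      adjoin3 x y z f -> adjoin3 x y z g -> adjoin3 x y z (f / g).

(* The points of the nonsingular model are the places of L / K, given by their
   normalized discrete valuations.  The value +oo at 0 is replaced by the
   conventional value 0, so that a place has exactly one valuation function. *)
Record place := Place {
  valuation :> L -> int;
  _ : valuation 0 = 0;
  _ : forall f g, f != 0 -> g != 0 ->
        valuation (f * g) = valuation f + valuation g;
  _ : forall f g, f != 0 -> g != 0 -> f + g != 0 ->
        Num.min (valuation f) (valuation g) <= valuation (f + g);
  _ : forall c : K, c != 0 -> valuation (iota c) = 0;
  _ : exists2 t, t != 0 & valuation t = 1
}.

Definition regular_at (R : place) (f : L) : Prop := f = 0 \/ 0 <= R f.

Definition vanishes_at (R : place) (f : L) : Prop := f = 0 \/ 0 < R f.

(* The projective map (x : y : z : 1) sends the place R to the K-rational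
   point (a : b : c : d): after scaling by a suitable t, the residues at R of
   the four coordinate functions are a, b, c, d. *)
Definition centered_at (x y z : L) (R : place) (a b c d : K) : Prop :=
  exists2 t : L, t != 0 &
    [/\ vanishes_at R (t * x - iota a), vanishes_at R (t * y - iota b),
        vanishes_at R (t * z - iota c) & vanishes_at R (t - iota d)].

Definition two_point_ring (Q P : place) (f : L) : Prop :=
  forall R : place, ~ R =1 Q -> ~ R =1 P -> regular_at R f.

Definition weierstrass_semigroup (Q P : place) (i j : int) : Prop :=
  exists f : L, [/\ two_point_ring Q P f, f != 0, Q f = - i & P f = - j].

End FunctionField.

Definition is_min (S : int -> Prop) (j : int) : Prop :=
  S j /\ forall j', S j' -> j <= j'.

(* [is_tau Q P i j] reads "tau_{Q,P}(i) = j"; it includes the existence of the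
   minimum. *)
Definition is_tau (K L : fieldType) (iota : {rmorphism K -> L})
    (Q P : place iota) (i j : int) : Prop :=
  is_min (weierstrass_semigroup Q P i) j.

Definition prime_power (q : nat) : Prop :=
  exists p e : nat, [/\ prime p, (0 < e)%N & q = (p ^ e)%N].

(* Both divisions are exact for q >= 2 and n odd. *)
Definition BM_m (q n : nat) : nat := ((q ^ n + 1) %/ (q + 1))%N.

Definition BM_M (q n : nat) : nat := ((BM_m q n - 1) %/ (q ^ 2 - q))%N.

(* L = K(x, y, z) is the function field of the Beelen-Montanucci curve.
   Transcendence of x and the two equations determine (L, x, y, z) up to
   K-isomorphism, because both equations stay irreducible: the first over
   K(x), the second over K(x, y). *)
Record BM_function_field (q n : nat) (K L : fieldType)
    (iota : {rmorphism K -> L}) (x y z : L) : Prop := BMFunctionField {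
  BM_transcendental : transcendental iota x;
  BM_hermitian : y ^+ (q + 1) = x ^+ (q + 1) - 1;
  BM_cover : z ^+ BM_m q n = y * ((x ^+ (q ^ 2) - x) / (x ^+ (q + 1) - 1));
  BM_generated : forall f : L, adjoin3 iota x y z f
}.

(* Main.v *)
(* Write [v = x - 1] and let [b = v / (x + y)], [u = 1 / (x + y) - 1], so that
   the Hermitian function field is [K(b, u)] with [u ^ (q+1) = b ^ q + b].  The
   function [u ^ l * b ^ k * (u + 1) ^ gamma * z ^ beta] has the required orders
   at [Q] and [P].

   Conversely, let [f] be regular outside [Q] and [P].  The function field is
   cyclic over [K(x)] with generator [z], so averaging over [q^n + 1]-st roots of
   unity shows that every component of [f] on the basis [z ^ j * y ^ r] is regular
   above each finite place of [K(x)] other than [x = 1].  A place above a given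
   irreducible polynomial is obtained from a maximal subring in which that
   polynomial is not invertible.  The values of the components at [Q], resp. of
   their [z]-parts at [P], are distinct, so it is enough to bound the order at [P]
   of the [z ^ beta]-part [z ^ beta * H].  Averaging over the [m]-th roots of unity
   only, this part is regular at the [q] conjugates of [P], where [u + 1] has a
   zero: up to a power of [u + 1], [H] is a polynomial in [b] and [u], whose
   monomials [b ^ i * u ^ j] with [j <= q] have distinct values at [Q] and at [P].
   The order at [Q] forces one precise monomial to occur, hence the order at [P]. *)
Require Import Defs.
From HB Require Import structures.
From mathcomp Require Import all_boot all_order all_algebra.
From mathcomp Require Import cyclic finfield.
From mathcomp Require Import zify ring.
From mathcomp Require Import boolp classical_sets.

Set Implicit Arguments.
Unset Strict Implicit.
Unset Printing Implicit Defensive.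

Import Order.TTheory GRing.Theory Num.Theory.
Local Open Scope ring_scope.

(** * Valuations *)

(** Everything hinges on [m = M (q^2 - q) + 1]. It makes [m] prime to [q^2 - q], so that the
    exponent of [z] can be read off a value at [P]; it makes [m] equal to [1] in [K], so that
    averages over roots of unity need no division; and it explains gamma. At the conjugates of [P],
    [z ^ beta] has a pole of order [beta (q^2 - q)] and [u + 1] a zero of order [m], so the exponent
    of [u + 1] must be at least [beta (q^2 - q) / m]. Rounded up, this is the same integer as
    [beta / M] rounded up, as long as [beta < m]. The obstacle is that [L] is known only through
    generators and equations, and places only as normalized valuations. The independence of the
    powers of [z], the automorphisms, the orders at [Q] and [P] and the uniqueness of these two
    places must all be derived. Total ramification at [Q] is the lever: powers of [z] below
    [q^n + 1] have values at [Q] that are distinct modulo that of [v]. Uniqueness matters because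
    the two-point ring exempts only valuations equal to [Q] or [P], not all zeros of [v]. *)

Section Valuation.

Variables (K L : fieldType) (iota : {rmorphism K -> L}).
Implicit Types (R : place iota) (f g : L).

Lemma val0 R : R 0 = 0. Proof. by case: R. Qed.

Lemma valM R f g : f != 0 -> g != 0 -> R (f * g) = R f + R g.
Proof. by case: R => v ? h ? ? ?; apply: h. Qed.

Lemma valD R f g :
  f != 0 -> g != 0 -> f + g != 0 -> Num.min (R f) (R g) <= R (f + g).
Proof. by case: R => v ? ? h ? ?; apply: h. Qed.

Lemma val_cst R c : R (iota c) = 0.
Proof.
have [->|cn0] := eqVneq c 0; first by rewrite rmorph0 val0.
by case: R => v ? ? ? h ?; apply: h.
Qed.

Lemma val_unif R : exists2 t, t != 0 & R t = 1.
Proof. by case: R. Qed.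

Lemma val_one R : R 1 = 0.
Proof. by rewrite -(rmorph1 iota) val_cst. Qed.

Lemma valX R f n : R (f ^+ n) = R f * n%:Z.
Proof.
suff -> : R (f ^+ n) = R f *+ n by rewrite -mulr_natr natz.
have [->|fn0] := eqVneq f 0.
  by rewrite expr0n val0 mul0rn; case: n => [|n] /=; rewrite ?val_one ?val0.
elim: n => [|n IH]; first by rewrite expr0 val_one.
by rewrite exprS valM ?expf_neq0 // IH mulrS.
Qed.

Lemma valV R f : R f^-1 = - R f.
Proof.
have [->|fn0] := eqVneq f 0; first by rewrite invr0 val0 oppr0.
have := valM R fn0 (invr_neq0 fn0); rewrite divff // val_one => h; lia.
Qed.

Lemma valN R f : R (- f) = R f.
Proof.
have [->|fn0] := eqVneq f 0; first by rewrite oppr0.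
have n1 : (-1 : L) != 0 by rewrite oppr_eq0 oner_neq0.
rewrite -mulN1r valM //.
suff -> : (-1 : L) = iota (-1) by rewrite val_cst add0r.
by rewrite rmorphN rmorph1.
Qed.

Lemma valXz R f (k : int) : R (f ^ k) = R f * k.
Proof.
case: k => n; first by rewrite -exprnP valX.
by rewrite NegzE -exprnN valV valX; lia.
Qed.

(* [val_ge R a f] is "[a <= R f]" for the valuation with value +oo at 0. *)
Definition val_ge R (a : int) f := f = 0 \/ a <= R f.

Lemma val_ge0 R a : val_ge R a 0. Proof. by left. Qed.

Lemma val_ge_refl R f : val_ge R (R f) f. Proof. by right. Qed.

Lemma val_geE R a f : f != 0 -> val_ge R a f -> a <= R f.
Proof. by move=> fn0 [f0|//]; rewrite f0 eqxx in fn0. Qed.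

Lemma val_ge_le R a b f : a <= b -> val_ge R b f -> val_ge R a f.
Proof. by move=> ab [->|h]; [left|right; apply: le_trans h]. Qed.

Lemma val_geD R a f g : val_ge R a f -> val_ge R a g -> val_ge R a (f + g).
Proof.
have [->|fn0] := eqVneq f 0; first by rewrite add0r.
have [->|gn0] := eqVneq g 0; first by rewrite addr0.
have [->|sn0] := eqVneq (f + g) 0; first by left.
move=> /(val_geE fn0) hf /(val_geE gn0) hg; right.
by apply: le_trans (valD R fn0 gn0 sn0); rewrite le_min hf.
Qed.

Lemma val_geN R a f : val_ge R a f -> val_ge R a (- f).
Proof. by move=> [->|h]; [left; rewrite oppr0|right; rewrite valN]. Qed.

Lemma val_geB R a f g : val_ge R a f -> val_ge R a g -> val_ge R a (f - g).
Proof. by move=> ? ?; apply: val_geD => //; apply: val_geN. Qed.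

Lemma val_geM R a b f g :
  val_ge R a f -> val_ge R b g -> val_ge R (a + b) (f * g).
Proof.
have [->|fn0] := eqVneq f 0; first by rewrite mul0r; left.
have [->|gn0] := eqVneq g 0; first by rewrite mulr0; left.
by move=> /(val_geE fn0) hf /(val_geE gn0) hg; right; rewrite valM // lerD.
Qed.

Lemma val_geX R f n : val_ge R 0 f -> val_ge R 0 (f ^+ n).
Proof.
move=> h; elim: n => [|n IH]; first by right; rewrite expr0 val_one.
by rewrite exprS -[0]addr0; apply: val_geM.
Qed.

Lemma val_ge_cst R c : val_ge R 0 (iota c).
Proof. by right; rewrite val_cst. Qed.

Lemma val_ge_sum R a (I : Type) (r : seq I) (S : pred I) (t : I -> L) :
  (forall i, S i -> val_ge R a (t i)) -> val_ge R a (\sum_(i <- r | S i) t i).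
Proof.
by move=> h; elim/big_ind: _ => //; [exact: val_ge0|exact: val_geD].
Qed.

Lemma val_addl R f g : f != 0 -> val_ge R (R f + 1) g ->
  f + g != 0 /\ R (f + g) = R f.
Proof.
move=> fn0 hg.
have sn0 : f + g != 0.
  apply/eqP => e; have ge : g = - f by apply/eqP; rewrite -addr_eq0 addrC e.
  have gn0 : g != 0 by rewrite ge oppr_eq0.
  by move: (val_geE gn0 hg); rewrite ge valN; lia.
split => //; apply/eqP; rewrite eq_le; apply/andP; split; last first.
  apply: val_geE sn0 _; apply: val_geD (val_ge_refl _ _) _.
  by apply: val_ge_le hg; lia.
rewrite leNgt; apply/negP => hlt.
have : val_ge R (R f + 1) (f + g - g).
  by apply: val_geB hg; right; lia.
by rewrite addrK => /(val_geE fn0); lia.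
Qed.

Lemma val_addl_lt R f g : f != 0 -> R f < R g -> f + g != 0 /\ R (f + g) = R f.
Proof. by move=> fn0 h; apply: val_addl => //; right; lia. Qed.

(** The term of least value is unique, so the others cannot cancel it. Values of expansions are
    computed in this way below. *)
Lemma val_sum_distinct R (I : finType) (t : I -> L) :
    (exists i, t i != 0) ->
    (forall i j, t i != 0 -> t j != 0 -> R (t i) = R (t j) -> i = j) ->
  exists i0, [/\ t i0 != 0, forall i, t i != 0 -> R (t i0) <= R (t i),
                 \sum_i t i != 0 & R (\sum_i t i) = R (t i0)].
Proof.
move=> [i1 ti1] inj.
case: (@Order.TotalTheory.arg_minP _ _ I i1 (fun i => t i != 0)
   (fun i => R (t i)) ti1) => i0 ti0 imin.
exists i0; split => //.
all: rewrite (bigD1 i0) //=.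
all: have [] // := @val_addl R (t i0) (\sum_(i | i != i0) t i) ti0 _.
all: apply: val_ge_sum => i ne; have [->|tin0] := eqVneq (t i) 0; 
  first exact: val_ge0.
all: right; have := imin i tin0; rewrite le_eqVlt => /orP[/eqP e|]; last by lia.
all: by move: ne; rewrite (inj i0 i ti0 tin0 e) eqxx.
Qed.

(** Each side is the least value of a term, and the two places give the terms the same values. This
    is the tool for showing that a place is determined by its values on a few generators. *)
Lemma val_sum_agree R R' (I : finType) (t : I -> L) :
    (forall i j, t i != 0 -> t j != 0 -> R (t i) = R (t j) -> i = j) ->
    (forall i, t i != 0 -> R' (t i) = R (t i)) ->
  R' (\sum_i t i) = R (\sum_i t i).
Proof.
move=> inj e; have [ex|nex] := pselect (exists i, t i != 0); last first.
  rewrite big1 ?val0 // => i _; apply/eqP; rewrite -[_ == _]negbK.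
  by apply/negP => h; apply: nex; exists i.
have [i0 [n0 m0 _ ->]] := val_sum_distinct ex inj.
have inj' i j : t i != 0 -> t j != 0 -> R' (t i) = R' (t j) -> i = j.
  by move=> hi hj; rewrite !e //; apply: inj.
have [i1 [n1 m1 _ ->]] := val_sum_distinct ex inj'.
apply/eqP; rewrite eq_le -{1}(e i0 n0) (m1 _ n0) /=.
by rewrite (e i1 n1) (m0 _ n1).
Qed.

Definition has_residue R f (c : K) := vanishes_at R (f - iota c).

Lemma vanishesE R f : vanishes_at R f <-> val_ge R 1 f.
Proof. by rewrite /vanishes_at /val_ge; split => -[->|h]; by [left|right; lia]. Qed.

Lemma residue_ge0 R f c : has_residue R f c -> val_ge R 0 f.
Proof.
move=> /vanishesE h; rewrite -(subrK (iota c) f).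
by apply: val_geD (val_ge_cst _ _); apply: val_ge_le h.
Qed.

Lemma residue_cst R c : has_residue R (iota c) c.
Proof. by left; rewrite subrr. Qed.

Lemma residue_self R f c : f = iota c -> has_residue R f c.
Proof. by move=> ->; exact: residue_cst. Qed.

Lemma residueD R f g c d :
  has_residue R f c -> has_residue R g d -> has_residue R (f + g) (c + d).
Proof.
move=> /vanishesE hf /vanishesE hg; apply/vanishesE.
by rewrite rmorphD opprD addrACA; apply: val_geD.
Qed.

Lemma residueN R f c : has_residue R f c -> has_residue R (- f) (- c).
Proof.
move=> /vanishesE hf; apply/vanishesE.
by rewrite rmorphN -opprD; apply: val_geN.
Qed.

Lemma residueB R f g c d :
  has_residue R f c -> has_residue R g d -> has_residue R (f - g) (c - d).
Proof. by move=> hf hg; apply: residueD => //; apply: residueN. Qed.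

Lemma residueM R f g c d :
  has_residue R f c -> has_residue R g d -> has_residue R (f * g) (c * d).
Proof.
move=> hf hg; have gf := residue_ge0 hf.
move: hf hg => /vanishesE hf /vanishesE hg; apply/vanishesE.
have -> : f * g - iota (c * d) = f * (g - iota d) + iota d * (f - iota c).
  by rewrite rmorphM; ring.
by apply: val_geD; [have := val_geM gf hg|have := val_geM (val_ge_cst R d) hf];
  rewrite add0r.
Qed.

Lemma residue0P R f : has_residue R f 0 <-> val_ge R 1 f.
Proof. by rewrite /has_residue rmorph0 subr0 vanishesE. Qed.

Lemma residue_val0 R f c : has_residue R f c -> c != 0 -> f != 0 /\ R f = 0.
Proof.
move=> /vanishesE h cn0.
have in0 : iota c != 0 by rewrite fmorph_eq0.
have := @val_addl R (iota c) (f - iota c) in0.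
by rewrite subrKC val_cst add0r => /(_ h) [? ->].
Qed.

Lemma residue_cst_eq0 R c d : has_residue R (iota c) d -> c = d.
Proof.
rewrite /has_residue -rmorphB => -[/eqP|]; last by rewrite val_cst ltxx.
by rewrite fmorph_eq0 subr_eq0 => /eqP.
Qed.

Lemma residue_inj R f c d : has_residue R f c -> has_residue R f d -> c = d.
Proof.
move=> hc hd; have := residueB hc hd; rewrite subrr -(rmorph0 iota).
by move/residue_cst_eq0/esym/eqP; rewrite subr_eq0 => /eqP.
Qed.

End Valuation.

(** * Polynomial expressions and their values *)

Section Evaluation.

Variables (K L : fieldType) (iota : {rmorphism K -> L}).
Implicit Types (R : place iota) (s t : L) (p : {poly K}) (T : {poly {poly K}}).

Definition ev s p : L := (map_poly iota p).[s].

Fact ev_is_zmod_morphism s : zmod_morphism (ev s).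
Proof. by move=> p p'; rewrite /ev rmorphB hornerD hornerN. Qed.

Fact ev_is_monoid_morphism s : monoid_morphism (ev s).
Proof.
by split=> [|p p']; rewrite /ev ?rmorph1 ?hornerC // rmorphM hornerM.
Qed.

HB.instance Definition _ s :=
  GRing.isZmodMorphism.Build {poly K} L (ev s) (ev_is_zmod_morphism s).
HB.instance Definition _ s :=
  GRing.isMonoidMorphism.Build {poly K} L (ev s) (ev_is_monoid_morphism s).

Definition ev2 s t T : L := (map_poly (ev s) T).[t].

Fact ev2_is_zmod_morphism s t : zmod_morphism (ev2 s t).
Proof. by move=> p p'; rewrite /ev2 rmorphB hornerD hornerN. Qed.

Fact ev2_is_monoid_morphism s t : monoid_morphism (ev2 s t).
Proof.
by split=> [|p p']; rewrite /ev2 ?rmorph1 ?hornerC // rmorphM hornerM.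
Qed.

HB.instance Definition _ s t :=
  GRing.isZmodMorphism.Build {poly {poly K}} L (ev2 s t) (ev2_is_zmod_morphism s t).
HB.instance Definition _ s t :=
  GRing.isMonoidMorphism.Build {poly {poly K}} L (ev2 s t) (ev2_is_monoid_morphism s t).

Arguments ev : simpl never.
Arguments ev2 : simpl never.

Lemma ev_horner s p : ev s p = (map_poly iota p).[s]. Proof. by []. Qed.

Lemma ev2_horner s t T : ev2 s t T = (map_poly (ev s) T).[t]. Proof. by []. Qed.

Lemma evE s p : ev s p = \sum_(i < size p) iota p`_i * s ^+ i.
Proof. by rewrite ev_horner horner_poly. Qed.

Lemma evC s c : ev s c%:P = iota c.
Proof. by rewrite ev_horner map_polyC hornerC. Qed.

Lemma evX s : ev s 'X = s.
Proof. by rewrite ev_horner map_polyX hornerX. Qed.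

Lemma evXn s n : ev s 'X^n = s ^+ n.
Proof. by rewrite rmorphXn /= evX. Qed.

Lemma ev2C s t p : ev2 s t p%:P = ev s p.
Proof. by rewrite ev2_horner map_polyC hornerC. Qed.

Lemma ev2X s t : ev2 s t 'X = t.
Proof. by rewrite ev2_horner map_polyX hornerX. Qed.

Lemma ev2E s t T n : (size T <= n)%N -> ev2 s t T = \sum_(i < n) ev s T`_i * t ^+ i.
Proof.
move=> h; rewrite ev2_horner.
rewrite (@horner_coef_wide _ n) ?(leq_trans (size_poly _ _)) //.
by apply: eq_bigr => i _; rewrite coef_map.
Qed.

Lemma ev2B s t T T' : ev2 s t (T - T') = ev2 s t T - ev2 s t T'.
Proof. exact: ev2_is_zmod_morphism. Qed.

Lemma ev2_reduce s t M T : M \is monic -> ev2 s t M = 0 ->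
  exists2 T' : {poly {poly K}}, (size T' < size M)%N & ev2 s t T = ev2 s t T'.
Proof.
move=> Mm M0; exists (Pdiv.Ring.rmodp T M).
  by rewrite Pdiv.Ring.ltn_rmodp monic_neq0.
rewrite {1}(Pdiv.RingMonic.rdivp_eq Mm T).
by rewrite rmorphD rmorphM /= M0 mulr0 add0r.
Qed.

Lemma ev2_swap s t T : exists T', ev2 s t T = ev2 t s T'.
Proof.
elim/poly_ind: T => [|T p [T' e]]; first by exists 0; rewrite !rmorph0.
have [T'' e'] : exists T'', ev s p = ev2 t s T''.
  exists (map_poly polyC p); rewrite ev_horner ev2_horner -map_poly_comp.
  by congr (_.[_]); apply: eq_map_poly => c /=; rewrite evC.
exists (T' * 'X%:P + T'').
by rewrite !rmorphD !rmorphM /= ev2X !ev2C evX e e'.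
Qed.

(** Terms of distinct degrees have distinct values because [R s] is not zero. Its sign is left open:
    the dominant [k] is the lowest degree at a zero of [s], the highest at a pole. *)
Lemma val_ev R s p : R s != 0 -> p != 0 ->
  exists k : nat, [/\ p`_k != 0, ev s p != 0, R (ev s p) = R s * k &
    forall k', p`_k' != 0 -> R s * k <= R s * k'].
Proof.
move=> Rs pn0; have sn0 : s != 0 by apply: contraNneq Rs => ->; rewrite val0.
pose t (i : 'I_(size p)) := iota p`_i * s ^+ i.
have tn0 i : (t i != 0) = (p`_i != 0).
  by rewrite mulf_eq0 expf_eq0 (negbTE sn0) andbF orbF fmorph_eq0.
have tR (i : 'I_(size p)) : p`_i != 0 -> R (t i) = R s * i.
  move=> h; rewrite valM ?expf_neq0 ?fmorph_eq0 // val_cst add0r valX; lia.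
have sz : (0 < size p)%N by rewrite lt0n size_poly_eq0.
have [||i0 [h1 h2 h3 h4]] := @val_sum_distinct _ _ _ R _ t.
- have ltp : ((size p).-1 < size p)%N by rewrite prednK.
  by exists (Ordinal ltp); rewrite tn0 /= -lead_coefE lead_coef_eq0.
- move=> i j; rewrite !tn0 => hi hj; rewrite !tR // => e; apply: val_inj => /=.
  by move/(mulfI Rs): e => /eqP; rewrite eqz_nat => /eqP.
rewrite tn0 in h1.
exists i0; rewrite evE; split => //; first by rewrite -tR.
move=> k' hk'; have ltk : (k' < size p)%N.
  by rewrite ltnNge; apply: contra hk' => hs; rewrite nth_default.
by have := h2 (Ordinal ltk); rewrite tn0 !tR //; apply.
Qed.

Lemma val_ev_lt0 R s p : R s < 0 -> p != 0 ->
  ev s p != 0 /\ R (ev s p) = R s * (size p).-1%:Z.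
Proof.
move=> s0 pn0; have [|k [h1 h2 h3 h4]] := @val_ev R s p _ pn0; first by lia.
have sz : (0 < size p)%N by rewrite lt0n size_poly_eq0.
split => //; rewrite h3.
have := h4 (size p).-1; rewrite -lead_coefE lead_coef_eq0 => /(_ pn0).
have : (k < size p)%N by rewrite ltnNge; apply: contra h1 => hs; rewrite nth_default.
move=> h5; rewrite ler_nM2l // => h6; have -> // : k = (size p).-1 by lia.
Qed.

(** With [a] and [b] the values of [s] and [t], the monomials [s ^ j * t ^ i] with [i < n] have
    pairwise distinct values. Only the exponent of [t] is bounded, since it can be reduced modulo an
    equation of [t]. *)
Definition independent_below (n : nat) (a b : int) :=
  forall i i' j j' : nat, (i < n)%N -> (i' < n)%N ->
    a * j%:Z + b * i%:Z = a * j'%:Z + b * i'%:Z -> i = i' /\ j = j'.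

Let tm s t T n k (ij : 'I_n * 'I_k) : L := iota T`_ij.1`_ij.2 * s ^+ ij.2 * t ^+ ij.1.

Let ev2_tm s t T n k : (size T <= n)%N -> (forall i : nat, (size (T`_i)%R <= k)%N) ->
  ev2 s t T = \sum_ij @tm s t T n k ij.
Proof.
move=> h1 h2; rewrite (ev2E _ _ h1).
rewrite -(pair_bigA _ (fun (i : 'I_n) (j : 'I_k) => @tm s t T n k (i, j))) /=.
apply: eq_bigr => i _; rewrite -mulr_suml; congr (_ * _).
rewrite ev_horner.
rewrite (@horner_coef_wide _ k) ?(leq_trans (size_poly _ _)) //.
by apply: eq_bigr => j _; rewrite coef_map.
Qed.

Lemma coef_size_bound T : exists k, forall i : nat, (size (T`_i)%R <= k)%N.
Proof.
exists (\max_(i < size T) size (T`_i)%R) => i.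
have [h|h] := ltnP i (size T); last by rewrite nth_default // size_poly0.
by rewrite (leq_bigmax (Ordinal h)).
Qed.

Lemma val_ev2 R s t T n : s != 0 -> t != 0 -> T != 0 -> (size T <= n)%N ->
    independent_below n (R s) (R t) ->
  exists i j : nat, [/\ (i < n)%N, T`_i`_j != 0, ev2 s t T != 0,
    R (ev2 s t T) = R s * j%:Z + R t * i%:Z &
    forall i' j', T`_i'`_j' != 0 ->
      R s * j%:Z + R t * i%:Z <= R s * j'%:Z + R t * i'%:Z].
Proof.
move=> sn0 tn0 Tn0 sT ind; have [k hk] := coef_size_bound T.
have T0 (ij : 'I_n * 'I_k) : (@tm s t T n k ij != 0) = (T`_ij.1`_ij.2 != 0).
  by rewrite !mulf_eq0 !expf_eq0 (negbTE sn0) (negbTE tn0) !andbF !orbF fmorph_eq0.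
have TR (ij : 'I_n * 'I_k) : T`_ij.1`_ij.2 != 0 ->
    R (@tm s t T n k ij) = R s * (ij.2 : nat)%:Z + R t * (ij.1 : nat)%:Z.
  move=> h; rewrite !valM ?mulf_neq0 ?expf_neq0 ?fmorph_eq0 // val_cst !valX; lia.
have inb i j : T`_i`_j != 0 -> (i < n)%N /\ (j < k)%N.
  move=> h; split.
    rewrite ltnNge; apply: contra h => hs.
    by rewrite (nth_default _ (leq_trans sT hs)) coef0.
  by rewrite ltnNge; apply: contra h => hs; rewrite nth_default // (leq_trans (hk i)).
have [||ij [h1 h2 h3 h4]] := @val_sum_distinct _ _ _ R _ (@tm s t T n k).
- have l0 : lead_coef (lead_coef T) != 0 by rewrite !lead_coef_eq0.
  have [hi hj] := inb _ _ l0.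
  by exists (Ordinal hi, Ordinal hj); rewrite T0.
- move=> [i j] [i' j']; rewrite !T0 /= => hi hj; rewrite !TR //= => e.
  by have [e1 e2] := ind _ _ _ _ (ltn_ord i) (ltn_ord i') e;
     rewrite (val_inj e1) (val_inj e2).
rewrite T0 in h1; exists (ij.1 : nat), (ij.2 : nat).
rewrite (ev2_tm _ _ sT hk); split => //; first by rewrite -TR.
move=> i' j' h; have [hi hj] := inb _ _ h.
by have := h2 (Ordinal hi, Ordinal hj); rewrite T0 !TR //=; apply.
Qed.

Lemma val_ev2_agree R R' s t T n : s != 0 -> t != 0 -> (size T <= n)%N ->
    independent_below n (R s) (R t) -> R' s = R s -> R' t = R t ->
  R' (ev2 s t T) = R (ev2 s t T).
Proof.
move=> sn0 tn0 sT ind es et.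
have [->|Tn0] := eqVneq T 0; first by rewrite rmorph0 !val0.
have [k hk] := coef_size_bound T.
rewrite (ev2_tm _ _ sT hk); apply: val_sum_agree.
- have T0 (ij : 'I_n * 'I_k) : (@tm s t T n k ij != 0) = (T`_ij.1`_ij.2 != 0).
    by rewrite !mulf_eq0 !expf_eq0 (negbTE sn0) (negbTE tn0) !andbF !orbF fmorph_eq0.
  move=> [i j] [i' j']; rewrite !T0 /= => hi hj.
  rewrite !valM ?mulf_neq0 ?expf_neq0 ?fmorph_eq0 // !val_cst !valX !add0r => e.
  have [|e1 e2] := ind i i' j j' (ltn_ord _) (ltn_ord _); first exact: e.
  by rewrite (val_inj e1) (val_inj e2).
- move=> [i j] h; have cn0 : iota T`_i`_j != 0.
    by apply: contraNneq h; rewrite /tm /= => ->; rewrite !mul0r.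
  by rewrite !valM ?mulf_neq0 ?expf_neq0 // !val_cst !valX es et.
Qed.

Lemma residue_ev R s p c :
  has_residue R s c -> has_residue R (ev s p) p.[c].
Proof.
move=> h; elim/poly_ind: p => [|p d IH].
  by rewrite rmorph0 horner0; apply: residue_self; rewrite rmorph0.
rewrite rmorphD rmorphM /= evX evC !hornerE.
by apply: residueD (residue_cst _ _); apply: residueM.
Qed.

Lemma residue_ev2 R s t T c d :
  has_residue R s c -> has_residue R t d -> has_residue R (ev2 s t T) T.[d%:P].[c].
Proof.
move=> hs ht; elim/poly_ind: T => [|T p IH].
  by rewrite rmorph0 !horner0; apply: residue_self; rewrite rmorph0.
rewrite rmorphD rmorphM /= ev2X ev2C !hornerE.
by apply: residueD; [apply: residueM|apply: residue_ev].
Qed.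

Lemma val_ge_ev R s p : val_ge R 0 s -> val_ge R 0 (ev s p).
Proof.
move=> h; rewrite evE; apply: val_ge_sum => i _; rewrite -[0]addr0.
by apply: val_geM; [exact: val_ge_cst|exact: val_geX].
Qed.

End Evaluation.

Arguments ev : simpl never.
Arguments ev2 : simpl never.

(** * Existence of places *)

Section NormalizePlace.

Variables (K L : fieldType) (iota : {rmorphism K -> L}) (A : L -> int).
Hypothesis A0 : A 0 = 0.
Hypothesis AM : forall f g, f != 0 -> g != 0 -> A (f * g) = A f + A g.
Hypothesis AD : forall f g, f != 0 -> g != 0 -> f + g != 0 ->
  Num.min (A f) (A g) <= A (f + g).
Hypothesis Ac : forall c : K, c != 0 -> A (iota c) = 0.

(** The values of [A] form a nonzero subgroup of the integers. Its least positive element is [d]; a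
    nonzero remainder modulo [d] would be a smaller positive value. *)
Lemma normalize_place : (exists t, A t != 0) ->
  exists (R : place iota) (d : int), 0 < d /\ forall f, A f = d * R f.
Proof.
move=> [t At].
have A1 : A 1 = 0 by rewrite -(rmorph1 iota) Ac // oner_neq0.
have AV f : A f^-1 = - A f.
  have [->|f0] := eqVneq f 0; first by rewrite invr0 A0 oppr0.
  have := AM f0 (invr_neq0 f0); rewrite divff // A1 => h; lia.
have AX f n : f != 0 -> A (f ^+ n) = A f * n%:Z.
  move=> f0; elim: n => [|n IH]; first by rewrite expr0 A1 mulr0.
  by rewrite exprS AM ?expf_neq0 // IH; lia.
have AXz f k : f != 0 -> A (f ^ k) = A f * k.
  move=> f0; case: k => n; first by rewrite -exprnP AX.
  by rewrite NegzE -exprnN AV AX //; lia.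
have ex : exists n : nat, `[< (0 < n)%N /\ exists f, A f = n%:Z >].
  exists `|A t|%N; apply/asboolP; split; first by lia.
  have [h|h] := lerP 0 (A t); first by exists t; lia.
  by exists t^-1; rewrite AV; lia.
case: (ex_minnP ex) => d /asboolP[d0 [u Au]] dmin.
have u0 : u != 0 by apply: contra_eq_neq Au => ->; rewrite A0; lia.
have dvd f : A f = d%:Z * (A f %/ d)%Z.
  have [->|f0] := eqVneq f 0; first by rewrite A0 div0z mulr0.
  have e := divz_eq (A f) d; have r0 := modz_ge0 (A f) (_ : d%:Z != 0).
  have r1 := ltz_pmod (A f) (_ : 0 < d%:Z).
  suff e0 : (A f %% d)%Z = 0 by rewrite {1}e e0 addr0 mulrC.
  apply/eqP; apply: contraT => ne.
  have := dmin `|(A f %% d)%Z|%N; rewrite (_ : `[< _ >]); first by lia.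
  apply/asboolP; split; first by lia.
  exists (f * u ^ (- (A f %/ d)%Z)).
  rewrite AM ?expfz_neq0 // AXz // Au.
  rewrite gez0_abs; last by apply: r0; lia.
  lia.
pose r f := (A f %/ d)%Z.
have rE f : A f = d%:Z * r f by [].
have di : 0 < d%:Z by lia.
have dn0 : d%:Z != 0 by lia.
have r0 : r 0 = 0 by rewrite /r A0 div0z.
have rM f g : f != 0 -> g != 0 -> r (f * g) = r f + r g.
  by move=> f0 g0; apply: (mulfI dn0); rewrite mulrDr -!rE AM.
have rD f g : f != 0 -> g != 0 -> f + g != 0 -> Num.min (r f) (r g) <= r (f + g).
  move=> f0 g0 s0; have := AD f0 g0 s0; rewrite !rE !ge_min.
  by rewrite !ler_pM2l.
have rc c : c != 0 -> r (iota c) = 0.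
  by move=> c0; apply: (mulfI dn0); rewrite -rE Ac // mulr0.
have ru : exists2 t, t != 0 & r t = 1.
  by exists u => //; apply: (mulfI dn0); rewrite -rE Au mulr1.
by exists (Place r0 rM rD rc ru), d%:Z.
Qed.

End NormalizePlace.

Lemma irredp_coprimep (K : fieldType) (pi p : {poly K}) :
  irreducible_poly pi -> ~~ (pi %| p) -> coprimep p pi.
Proof.
move=> [_ irr] nd; rewrite coprimep_sym; apply/coprimepP => d dpi dp.
have [|ne] := boolP (size d == 1%N); first by rewrite -size_poly_eq1.
by rewrite -(eqp_dvdl _ (irr d ne dpi)) dp in nd.
Qed.

Lemma irredp_factor (K : fieldType) (p : {poly K}) : (1 < size p)%N ->
  exists2 pi, irreducible_poly pi & pi %| p.
Proof.
have [n] := ubnP (size p); elim: n p => // n IH p sp s1.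
have [irr|nirr] := pselect (irreducible_poly p); first by exists p.
have [d [d1 dp nd]] : exists d : {poly K}, [/\ size d != 1%N, d %| p & ~~ (d %= p)].
  have nex := nirr; apply: contrapT => h; apply: nex; split=> // d d1 dp.
  by apply: contraT => nd; case: h; exists d.
have p0 : p != 0 by rewrite -size_poly_gt0 ltnW.
have d0 : d != 0 by apply: contraTneq dp => ->; rewrite dvd0p.
have sd : (size d < size p)%N.
  by rewrite ltn_neqAle dvdp_leq // andbT -(dvdp_size_eqp dp) in nd *.
have [||pi ? pid] := IH d.
- exact: leq_trans sd sp.
- by move: d0 d1; rewrite -size_poly_gt0; case: (size d) => [|[]].
by exists pi => //; apply: dvdp_trans dp.
Qed.

Section ExtendPlace.

Variables (K L : fieldType) (iota : {rmorphism K -> L}) (v : L).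
Hypothesis v_tr : forall p : {poly K}, p != 0 -> ev iota v p != 0.
Variable deg : nat.
Hypothesis v_alg : forall f : L, exists T : {poly {poly K}},
  [/\ T != 0, (size T <= deg.+1)%N & ev2 iota v f T = 0].
Variable pi : {poly K}.
Hypothesis pi_irr : irreducible_poly pi.

Let w : L := ev iota v pi.

Let w_neq0 : w != 0.
Proof. exact/v_tr/irredp_neq0. Qed.

(** The competitors in Chevalley's extension theorem. A maximal one is a valuation ring and yields
    the place. *)
Definition nonunit_ring (S : set L) :=
  [/\ forall p, S (ev iota v p), forall f g, S f -> S g -> S (f - g),
      forall f g, S f -> S g -> S (f * g) & ~ S w^-1].

Lemma exists_maximal_nonunit_ring : exists V : set L, nonunit_ring V /\
  forall S, nonunit_ring S -> (V `<=` S)%classic -> S = V.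
Proof.
pose A0 : set L := fun f => exists p, f = ev iota v p.
have gA0 : nonunit_ring A0.
  split; first by move=> p; exists p.
  - by move=> _ _ [p ->] [p' ->]; exists (p - p'); rewrite rmorphB.
  - by move=> _ _ [p ->] [p' ->]; exists (p * p'); rewrite rmorphM.
  - move=> [p e].
    have : p * pi != 1.
      apply/eqP => e1; have [s1 _] := pi_irr.
      have : size (p * pi) = 1%N by rewrite e1 size_poly1.
      have pn0 : p != 0 by apply: contra_eq_neq e1 => ->; rewrite mul0r eq_sym oner_neq0.
      rewrite size_mul ?(irredp_neq0 pi_irr) //.
      move: s1 pn0; rewrite -size_poly_gt0; set a := size pi; set c := size p => ? ? ?.
      lia.
    rewrite -subr_eq0 => /v_tr; rewrite rmorphB rmorphM /= -e rmorph1 -/w.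
    by rewrite mulVf // subrr eqxx.
pose P (S : set L) := S = set0 \/ nonunit_ring S.
have [F FP Ft|V [PV Vmax]] := @Zorn_bigcup L P.
  have [[S0 [FS0 gS0]]|nex] := pselect (exists S, F S /\ nonunit_ring S); last first.
    left; apply/seteqP; split=> // f [S FS Sf].
    have [S0|gS] := FP S FS; first by move: Sf; rewrite S0.
    by case: nex; exists S.
  right.
  have pick f : (\bigcup_(X in F) X)%classic f ->
      exists S, [/\ F S, nonunit_ring S & S f].
    move=> [S FS Sf]; exists S; split => //.
    by have [e|//] := FP S FS; move: Sf; rewrite e.
  have pick2 f g : (\bigcup_(X in F) X)%classic f -> (\bigcup_(X in F) X)%classic g ->
      exists S, [/\ F S, nonunit_ring S, S f & S g].
    move=> /pick[S [FS gS Sf]] /pick[S' [FS' gS' Sg]].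
    have [h|h] := Ft S S' FS FS'.
      by exists S'; split => //; apply: h.
    by exists S; split => //; apply: h.
  split.
  - by move=> p; exists S0 => //; case: gS0.
  - move=> f g hf hg; have [S [FS gS Sf Sg]] := pick2 f g hf hg.
    by exists S => //; case: gS => _ h _ _; apply: h.
  - move=> f g hf hg; have [S [FS gS Sf Sg]] := pick2 f g hf hg.
    by exists S => //; case: gS => _ _ h _; apply: h.
  - by move=> /pick[S [_ [_ _ _ h] /h]].
have gV : nonunit_ring V.
  have [e|//] := PV.
  case: (Vmax A0); last by right.
  rewrite e; split=> // h0; have [h _ _ _] := gA0.
  exact: h0 (h 0).
exists V; split => // S gS VS; apply/seteqP; split => //.
by apply: contrapT => SV; apply: (Vmax S); [split|right].
Qed.

Section MaximalRing.

Variable V : set L.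
Hypothesis V_ring : nonunit_ring V.
Hypothesis V_max : forall S, nonunit_ring S -> (V `<=` S)%classic -> S = V.

Let Vev p : V (ev iota v p). Proof. by case: V_ring. Qed.
Let VB f g : V f -> V g -> V (f - g). Proof. by case: V_ring => _ h _ _; apply: h. Qed.
Let VM f g : V f -> V g -> V (f * g). Proof. by case: V_ring => _ _ h _; apply: h. Qed.
Let VnV : ~ V w^-1. Proof. by case: V_ring. Qed.
Let Vc c : V (iota c). Proof. by rewrite -(evC iota v). Qed.
Let V0 : V 0. Proof. by rewrite -(rmorph0 iota). Qed.
Let V1 : V 1. Proof. by rewrite -(rmorph1 iota). Qed.
Let VN f : V f -> V (- f). Proof. by move=> h; rewrite -sub0r; apply: VB. Qed.
Let VD f g : V f -> V g -> V (f + g).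
Proof. by move=> hf hg; rewrite -[g]opprK; apply: VB => //; apply: VN. Qed.
Let VX f n : V f -> V (f ^+ n).
Proof. by move=> h; elim: n => [|n IH]; rewrite ?expr0 // exprS; apply: VM. Qed.
Let Vw : V w. Proof. exact: Vev. Qed.

(* By maximality of [V], [1 / w] belongs to [V[t]]. *)
Let V_adjoin t : ~ V t -> exists2 p : {poly L}, forall i, V p`_i & w * p.[t] = 1.
Proof.
move=> nVt; apply: contrapT => nex.
pose S : set L := fun f => exists2 p : {poly L}, forall i, V p`_i & f = p.[t].
have gS : nonunit_ring S.
  split.
  - move=> p; exists (ev iota v p)%:P; last by rewrite hornerC.
    by move=> i; rewrite coefC; case: eqP.
  - move=> _ _ [p hp ->] [p' hp' ->]; exists (p - p'); last by rewrite !hornerE.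
    by move=> i; rewrite coefB; apply: VB.
  - move=> _ _ [p hp ->] [p' hp' ->]; exists (p * p'); last by rewrite hornerM.
    by move=> i; rewrite coefM; elim/big_ind: _ => // j _; apply: VM.
  - move=> [p hp e]; apply: nex; exists p => //.
    by rewrite -e divff.
case: nVt; rewrite -(V_max gS); last first.
  move=> f Vf; exists f%:P; last by rewrite hornerC.
  by move=> i; rewrite coefC; case: eqP.
exists 'X; last by rewrite hornerX.
by move=> i; rewrite coefX; case: eqP.
Qed.

(** If [t = 1 - w f] were not invertible in [V], then [1 / w] would be a polynomial in [1 / t] over
    [V]. A large power of [t] clears the denominators, and it is [1] modulo [w V], so [1 / w] would
    lie in [V]. *)
Let V_unit1 f : V f -> V (1 - w * f)^-1.
Proof.
move=> Vf; pose t := 1 - w * f.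
have Vt : V t by apply: VB => //; apply: VM.
have [tn0|t0] := eqVneq t 0; first by rewrite -/t tn0 invr0.
apply: contrapT => nV; have [p hp e] := V_adjoin nV.
have key k : V (1 - t ^+ k) /\ exists2 g, V g & 1 - t ^+ k = w * g.
  elim: k => [|k [IH1 [g Vg IH2]]].
    by rewrite expr0 subrr; split => //; exists 0; rewrite ?mulr0.
  have e1 : 1 - t ^+ k.+1 = w * (f + t * g).
    by rewrite exprS mulrDr mulrCA -IH2 /t; ring.
  split; first by rewrite e1; apply: VM => //; apply: VD => //; apply: VM.
  by exists (f + t * g) => //; apply: VD => //; apply: VM.
have [_ [g Vg e2]] := key (size p).
apply: VnV.
have e3 : t ^+ (size p) * p.[t^-1] = \sum_(i < size p) p`_i * t ^+ (size p - i).
  rewrite horner_coef mulr_sumr; apply: eq_bigr => i _.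
  rewrite mulrCA; congr (_ * _); rewrite exprVn -expfB_cond //.
  by rewrite (negbTE t0) add0n; apply: ltnW.
have V3 : V (t ^+ (size p) * p.[t^-1]).
  by rewrite e3; elim/big_ind: _ => // i _; apply: VM => //; apply: VX.
have -> : w^-1 = g + t ^+ (size p) * p.[t^-1].
  apply: (mulfI w_neq0); rewrite mulfV // mulrDr -e2 mulrCA e mulr1.
  by rewrite subrK.
exact: VD.
Qed.

(** The relation for [1 / t], multiplied by a power of [t], expresses [t ^ m'.+1] through lower
    powers once the unit [1 - w * r_0] is divided out. Substituted into the leading term of the
    relation for [t], it lowers the degree; this needs [m' <= n]. *)
Let Vpow_lin t n : forall m' : nat, (m' <= n)%N ->
  (exists p : {poly L}, [/\ forall i, V p`_i, (size p <= n.+2)%N & w * p.[t] = 1]) ->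
  (exists p : {poly L}, [/\ forall i, V p`_i, (size p <= m'.+2)%N & w * p.[t^-1] = 1]) ->
  t != 0 ->
  exists p : {poly L}, [/\ forall i, V p`_i, (size p <= n.+1)%N & w * p.[t] = 1].
Proof.
move=> m' mn [p [hp sp ep]] [r [hr sr er]] t0.
(* t ^ (m'+1) is a polynomial of degree at most m' in t, coefficients in w V *)
pose c := (1 - w * r`_0)^-1.
have Vcc : V c by apply: V_unit1.
have d0 : 1 - w * r`_0 != 0.
  apply/eqP => e; apply: VnV; suff -> : w^-1 = r`_0 by [].
  by apply: (mulfI w_neq0); rewrite mulfV //; apply/eqP; rewrite -subr_eq0 e.
pose s : {poly L} := \poly_(i < m'.+1) (c * r`_(m'.+1 - i)).
have es : t ^+ m'.+1 = w * s.[t].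
  have e1 : w * (\sum_(1 <= i < m'.+2) r`_i * t^-1 ^+ i) = 1 - w * r`_0.
    move: er; rewrite (horner_coef_wide _ sr) -(big_mkord xpredT (fun i => r`_i * t^-1 ^+ i)).
    rewrite big_nat_recl // expr0 mulr1 big_add1 /= mulrDr => <-.
    by rewrite [w * _ + _]addrC addrK.
  have e2 : c * (w * (\sum_(1 <= i < m'.+2) r`_i * t^-1 ^+ i)) = 1.
    by rewrite e1 mulVf.
  have e3 : t ^+ m'.+1 * (\sum_(1 <= i < m'.+2) r`_i * t^-1 ^+ i) =
      \sum_(i < m'.+1) r`_(m'.+1 - i) * t ^+ i.
    rewrite -(big_mkord xpredT (fun i => r`_(m'.+1 - i) * t ^+ i)).
    rewrite [RHS]big_nat_rev /= big_add1 mulr_sumr; apply: eq_big_nat => i /andP[_ hi].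
    rewrite mulrCA exprVn -expfB_cond ?(negbTE t0) ?add0n //.
    by congr (_`__ * _ ^+ _); lia.
  have -> : s.[t] = c * (\sum_(i < m'.+1) r`_(m'.+1 - i) * t ^+ i).
    by rewrite horner_poly mulr_sumr; apply: eq_bigr => i _; rewrite mulrA.
  by rewrite -e3 -[LHS]mulr1 -e2; ring.
have Vs i : V s`_i.
  by rewrite coef_poly; case: ifP => // _; apply: VM.
pose a := p`_n.+1.
pose p1 := (p - a *: 'X^(n.+1)) + (a * w) *: (s * 'X^(n - m')).
exists p1; split.
- move=> i; rewrite coefD coefB !coefZ coefXn coefMXn.
  apply: VD; last by apply: VM; [apply: VM (hp _) Vw|case: ltnP].
  by apply: VB => //; apply: VM (hp _) _; case: (_ == _).
- apply: (leq_trans (size_polyD _ _)); rewrite geq_max; apply/andP; split.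
    apply/leq_sizeP => j hj; rewrite coefB coefZ coefXn.
    have [->|ne] := eqVneq j n.+1; first by rewrite mulr1 subrr.
    by rewrite mulr0 subr0 nth_default // (leq_trans sp) // ltn_neqAle eq_sym ne.
  apply: (leq_trans (size_scale_leq _ _)).
  apply/leq_sizeP => j hj; rewrite coefMXn; case: ltnP => // h.
  by rewrite coef_poly ltnNge (_ : m'.+1 <= j - (n - m'))%N //; lia.
- rewrite -ep; congr (w * _); rewrite !hornerD hornerN !hornerZ hornerM !hornerXn.
  have -> : a * w * (s.[t] * t ^+ (n - m')) = a * t ^+ n.+1.
    rewrite -mulrA (mulrA w) -es -exprD; congr (_ * _ ^+ _); lia.
  by rewrite subrK.
Qed.

(** Descent on the sum of the degrees: the longer relation is shortened by the other, after
    exchanging [t] and [1 / t] if needed. A relation of degree [0] would put [1 / w] into [V]. *)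
Let V_relations s : forall t n m', (n + m' <= s)%N -> t != 0 ->
  (exists p : {poly L}, [/\ forall i, V p`_i, (size p <= n.+1)%N & w * p.[t] = 1]) ->
  (exists p : {poly L}, [/\ forall i, V p`_i, (size p <= m'.+1)%N & w * p.[t^-1] = 1]) ->
  False.
Proof.
have base t :
    ~ (exists p : {poly L}, [/\ forall i, V p`_i, (size p <= 1)%N & w * p.[t] = 1]).
  move=> [p [hp sp ep]]; apply: VnV; suff -> : w^-1 = p`_0 by [].
  by apply: (mulfI w_neq0); rewrite mulfV // -ep {1}(size1_polyC sp) hornerC.
elim: s => [|s IH] t [|n] [|m'] hs t0 h1 h2;
  try (by [apply: base h1|apply: base h2|lia]).
have [le|lt] := leqP m' n.
  apply: (IH t n m'.+1 _ t0 _ h2); first by lia.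
  exact: Vpow_lin le h1 h2 t0.
apply: (IH t n.+1 m' _ t0 h1); first by lia.
apply: (@Vpow_lin t^-1 m' n (ltnW lt) h2 _ _); last by rewrite invr_neq0.
by rewrite invrK.
Qed.

Lemma maximal_ring_valuation t : t != 0 -> V t \/ V t^-1.
Proof.
move=> t0; apply: contrapT => /not_orP[h1 h2].
have [p hp ep] := V_adjoin h1; have [r hr er] := V_adjoin h2.
apply: (@V_relations (size p + size r) t (size p) (size r)) => //.
  by exists p; split.
by exists r; split.
Qed.

Let V_coprime p : coprimep p pi -> V (ev iota v p)^-1.
Proof.
move=> /Bezout_eq1_coprimepP[[a c] /= e].
have e1 : ev iota v a * ev iota v p = 1 - w * ev iota v c.
  by rewrite -(rmorph1 (ev iota v)) -e rmorphD !rmorphM /= [ev _ _ c * _]mulrC addrK.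
have d0 : 1 - w * ev iota v c != 0.
  apply/eqP => e0; apply: VnV; suff -> : w^-1 = ev iota v c by [].
  by apply: (mulfI w_neq0); rewrite mulfV //; apply/eqP; rewrite -subr_eq0 e0.
have pn0 : ev iota v p != 0 by apply: contraNneq d0 => p0; rewrite -e1 p0 mulr0.
have -> : (ev iota v p)^-1 = ev iota v a * (1 - w * ev iota v c)^-1.
  by apply: (mulIf pn0); rewrite mulVf // mulrAC e1 divff.
by apply: VM => //; apply: V_unit1.
Qed.


(* [U (f / g)] says that [f] and [g] have the same value. *)
Let U f := V f /\ V f^-1.

Let UM f g : U f -> U g -> U (f * g).
Proof. by move=> [? ?] [? ?]; split; rewrite ?invfM; apply: VM. Qed.

Let UV f : U f -> U f^-1.
Proof. by move=> [? ?]; split; rewrite ?invrK. Qed.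

Let UX f n : U f -> U (f ^+ n).
Proof. by move=> [? ?]; split; rewrite -?exprVn; apply: VX. Qed.

Let max_term (s : seq L) : s != [::] -> all (fun t => t != 0) s ->
  exists2 t, t \in s & forall t', t' \in s -> V (t' / t).
Proof.
elim: s => // a s IH _ /= /andP[a0 hs].
have [->|sn0] := eqVneq s [::].
  by exists a; rewrite ?mem_head // => t'; rewrite inE => /eqP ->; rewrite divff.
have [t ts ht] := IH sn0 hs; have t0 := allP hs _ ts.
have [h|h] := @maximal_ring_valuation (a / t) (mulf_neq0 a0 (invr_neq0 t0)).
  exists t; first by rewrite inE ts orbT.
  by move=> t'; rewrite inE => /orP[/eqP ->|/ht].
exists a; first exact: mem_head.
move=> t'; rewrite inE => /orP[/eqP ->|/ht ht']; first by rewrite divff.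
have -> : t' / a = (t' / t) * (a / t)^-1 by field; rewrite a0 t0.
exact: VM.
Qed.

(** The maximal ideal of [V]. Zero is listed apart because [0^-1] is [0], which lies in [V]. *)
Let M f := V f /\ (f = 0 \/ ~ V f^-1).

Let MD f g : M f -> M g -> M (f + g).
Proof.
move=> [Vf Mf] [Vg Mg]; split; first exact: VD.
case: Mf => [->|nf]; first by rewrite add0r.
case: Mg => [->|ng]; first by rewrite addr0; right.
have [s0|s0] := eqVneq (f + g) 0; first by left.
right => hs.
have f0 : f != 0 by apply/eqP => e; apply: nf; rewrite e invr0.
have g0 : g != 0 by apply/eqP => e; apply: ng; rewrite e invr0.
have [h|h] := @maximal_ring_valuation (f / g) (mulf_neq0 f0 (invr_neq0 g0)).
  apply: ng; have -> : g^-1 = (f + g)^-1 * (f / g + 1) by field; rewrite g0 s0.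
  by apply: VM => //; apply: VD.
apply: nf; have -> : f^-1 = (f + g)^-1 * (1 + (f / g)^-1) by field; rewrite f0 g0 s0.
by apply: VM => //; apply: VD.
Qed.

(** Divide by a term of least value. If no other term were a unit multiple of it, the remaining
    quotients would all lie in the ideal [M], yet they sum to [-1]. *)
Let two_terms (I : eqType) (s : seq I) (t : I -> L) : uniq s -> s != [::] ->
  (forall i, i \in s -> t i != 0) -> \sum_(i <- s) t i = 0 ->
  exists i j, [/\ i \in s, j \in s, i != j & U (t i / t j)].
Proof.
move=> us s0 tn0 e.
have [||_ /mapP[j js ->] jmax] := @max_term [seq t i | i <- s].
- by case: (s) s0.
- by apply/allP => _ /mapP[i hi ->]; apply: tn0.
apply: contrapT => nex.
suff : M (-1).
  move=> [_ [/eqP|]]; first by rewrite oppr_eq0 oner_eq0.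
  by rewrite invrN1; apply; apply: VN.
have -> : -1 = \sum_(i <- rem j s) t i / t j.
  rewrite -mulr_suml; move: e; rewrite (big_rem j js) /= => /eqP.
  by rewrite addrC addr_eq0 => /eqP ->; rewrite mulNr divff // tn0.
rewrite big_seq; elim/big_ind: _.
- by split => //; left.
- exact: MD.
move=> i; rewrite mem_rem_uniq // inE => /andP[ne hi].
have Vi : V (t i / t j) by apply: jmax; apply: map_f.
split => //; right => h; apply: nex; exists i, j; split => //.
Qed.

(** On [K[v]] the exponent is the multiplicity of [pi]: a cofactor prime to [pi] is a unit of [V] by
    Bezout. *)
Let ev_power c : c != 0 -> exists k : nat, U (ev iota v c / w ^+ k).
Proof.
have [n] := ubnP (size c); elim: n c => // n IH c sc c0.
have [/dvdpP[c' e]|nd] := boolP (pi %| c).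
  have c'0 : c' != 0 by apply: contraNneq c0 => h; rewrite e h mul0r.
  have s1 : (1 < size pi)%N by case: pi_irr.
  have sz : (size c' < n)%N.
    move: sc; rewrite e size_mul ?(irredp_neq0 pi_irr) //.
    by move: c'0 s1; rewrite -size_poly_gt0; set a := size pi; set b := size c'; lia.
  have [k hk] := IH c' sz c'0; exists k.+1.
  rewrite e rmorphM /= exprS -/w.
  have -> // : ev iota v c' * w / (w * w ^+ k) = ev iota v c' / w ^+ k.
  by field; rewrite expf_neq0 // w_neq0.
exists 0; rewrite expr0 divr1; split => //; apply: V_coprime.
exact: irredp_coprimep.
Qed.

(** Two terms of the equation of [f] have the same value, so [f ^ (i - j)] is a power of [w] up to a
    unit. Since [i - j] is at most [deg], it divides the factorial of [deg]. The uniform degree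
    bound thus gives one exponent for all [f], which makes the value group discrete. *)
Let order_exists f : f != 0 -> exists a : int, U (f ^+ deg`! / w ^ a).
Proof.
move=> f0; have [T [T0 sT eT]] := v_alg f.
pose s := [seq i <- index_iota 0 (size T) | T`_i != 0].
pose t i := ev iota v T`_i * f ^+ i.
have mems i : i \in s -> T`_i != 0 /\ (i < size T)%N.
  by rewrite mem_filter mem_index_iota => /andP[].
have [||||i [j [hi hj ne Uij]]] := @two_terms _ s t.
- by rewrite filter_uniq // iota_uniq.
- have : (size T).-1 \in s.
    rewrite mem_filter -lead_coefE lead_coef_eq0 T0 mem_index_iota /=.
    by rewrite prednK // size_poly_gt0.
  by case: (s).
- by move=> i /mems[h _]; rewrite mulf_neq0 ?expf_neq0 ?v_tr.
- rewrite big_filter big_mkcond big_mkord -[RHS]eT (ev2E _ _ _ (leqnn _)).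
  apply: eq_bigr => i _; rewrite /t; case: eqP => //= ->.
  by rewrite rmorph0 mul0r.
have {ne Uij} : exists i j, [/\ i \in s, j \in s, (j < i)%N & U (t i / t j)].
  have [h|h|h] := ltngtP i j; last by rewrite h eqxx in ne.
    by exists j, i; split => //; rewrite -invf_div; apply: UV.
  by exists i, j.
move=> {i j hi hj} [i [j [/mems[Ti si] /mems[Tj sj] ji Uij]]].
have [ki Ui] := ev_power Ti; have [kj Uj] := ev_power Tj.
pose d := (i - j)%N.
have dd : (d %| deg`!)%N by apply: dvdn_fact; rewrite /d; lia.
have Ud : U (f ^+ d * (w ^+ ki / w ^+ kj)).
  have -> : f ^+ d * (w ^+ ki / w ^+ kj) =
    (t i / t j) * (ev iota v T`_i / w ^+ ki)^-1 * (ev iota v T`_j / w ^+ kj).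
    rewrite /t /d (_ : f ^+ i = f ^+ (i - j) * f ^+ j); last by rewrite -exprD subnK // ltnW.
    by field; rewrite /= ?v_tr ?expf_neq0.
  by apply: UM => //; apply: UM => //; apply: UV.
case/dvdnP: dd => k ek.
exists ((kj%:Z - ki%:Z) * k%:Z); rewrite ek mulnC exprM.
have -> : (w ^ ((kj%:Z - ki%:Z) * k%:Z))^-1 = (w ^+ ki / w ^+ kj) ^+ k.
  rewrite -exprz_exp -exprnP -exprVn; congr (_ ^+ k).
  by rewrite invr_expz opprB expfzDr // -exprnN -exprnP.
by rewrite -exprMn; apply: UX.
Qed.

Let U_wX a : U (w ^ a) -> a = 0.
Proof.
have neg n : ~ V (w ^ (- n.+1%:Z)).
  move=> h; apply: VnV.
  have -> : w^-1 = w ^ (- n.+1%:Z) * w ^+ n.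
    by rewrite -exprnN exprS; field; rewrite expf_neq0.
  by apply: VM => //; apply: VX.
case: a => [[|n]|n] // [h1 h2]; last by case: (neg n); rewrite NegzE in h1.
by case: (neg n); rewrite -invr_expz.
Qed.

Lemma maximal_ring_place : exists R : place iota, 0 < R w /\ 0 <= R v.
Proof.
(* [A f] is the value of [f] on the scale where [w] has value the factorial of [deg]. On that scale
   all values are integers, and only the normalization remains. *)
have [A hA] : exists A : L -> int, forall f, (f = 0 -> A f = 0) /\
    (f != 0 -> U (f ^+ deg`! / w ^ (A f))).
  have /choice[A hA] : forall f : L, exists a : int, (f = 0 -> a = 0) /\
      (f != 0 -> U (f ^+ deg`! / w ^ a)).
    move=> f; have [->|f0] := eqVneq f 0; first by exists 0.
    have [a ha] := order_exists f0; exists a; split => // e.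
    by rewrite e eqxx in f0.
  by exists A.
have A0 : A 0 = 0 by have [-> //] := hA 0.
have Aeq f a : f != 0 -> U (f ^+ deg`! / w ^ a) -> A f = a.
  move=> f0 h; have [_ /(_ f0) h'] := hA f.
  apply/eqP; rewrite -subr_eq0; apply/eqP; apply: U_wX.
  have -> : w ^ (A f - a) = (f ^+ deg`! / w ^ a) * (f ^+ deg`! / w ^ (A f))^-1.
    by rewrite expfzDr // -invr_expz; field; rewrite expf_neq0 ?expfz_neq0.
  by apply: UM => //; apply: UV.
have AM f g : f != 0 -> g != 0 -> A (f * g) = A f + A g.
  move=> f0 g0; apply: Aeq; first exact: mulf_neq0.
  have [_ /(_ f0) hf] := hA f; have [_ /(_ g0) hg] := hA g.
  have -> : (f * g) ^+ deg`! / w ^ (A f + A g) =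
      (f ^+ deg`! / w ^ (A f)) * (g ^+ deg`! / w ^ (A g)).
    by rewrite exprMn expfzDr //; field; rewrite !expfz_neq0.
  exact: UM.
have AV f : f != 0 -> A f^-1 = - A f.
  move=> f0; apply: Aeq; first by rewrite invr_eq0.
  have [_ /(_ f0) hf] := hA f; have := UV hf; congr U.
  by rewrite exprVn invfM invrK -invr_expz invrK.
have Age0 f : V f -> 0 <= A f.
  have [->|f0 Vf] := eqVneq f 0; first by rewrite A0.
  rewrite leNgt; apply/negP => hlt; have [_ /(_ f0) [_ hf]] := hA f.
  apply: VnV; case: (A f) hlt hf => // n _; rewrite NegzE -exprnN invrK => hf.
  have -> : w^-1 = (f ^+ deg`! * w ^+ n.+1)^-1 * (f ^+ deg`! * w ^+ n).
    rewrite [w ^+ n.+1]exprS; field.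
    by apply/and3P; split; [exact: expf_neq0|exact: w_neq0|exact: expf_neq0].
  by apply: VM => //; apply: VM; apply: VX.
have Ac c : c != 0 -> A (iota c) = 0.
  move=> c0; have ic0 : iota c != 0 by rewrite fmorph_eq0.
  have := Age0 _ (Vc c^-1); rewrite fmorphV AV // oppr_ge0 => h.
  by apply/eqP; rewrite eq_le h Age0.
have AD f g : f != 0 -> g != 0 -> f + g != 0 -> Num.min (A f) (A g) <= A (f + g).
  have D1 x y : x != 0 -> y != 0 -> x + y != 0 -> V (x / y) -> A y <= A (x + y).
    move=> x0 y0 s0 h; have e : x + y = y * (x / y + 1) by field.
    have n0 : x / y + 1 != 0 by apply: contraNneq s0; rewrite e => ->; rewrite mulr0.
    by rewrite e AM // lerDl; apply/Age0/VD.
  move=> f0 g0 s0; rewrite ge_min.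
  have [h|h] := @maximal_ring_valuation (f / g) (mulf_neq0 f0 (invr_neq0 g0)).
    by rewrite (D1 f g) // orbT.
  by rewrite addrC (D1 g f) // 1?addrC // -invf_div.
have Aw : A w = deg`!%:Z.
  apply: Aeq; first exact: w_neq0.
  by rewrite -exprnP divff ?(expf_neq0 _ w_neq0) //; split; rewrite ?invr1.
have [|R [d [d0 hR]]] := normalize_place A0 AM AD Ac.
  by exists w; rewrite Aw; have := fact_gt0 deg; lia.
exists R; split.
  by rewrite -(pmulr_rgt0 _ d0) -hR Aw; have := fact_gt0 deg; lia.
by rewrite -(pmulr_rge0 _ d0) -hR; apply: Age0; rewrite -(evX iota v).
Qed.

End MaximalRing.
Lemma place_over_irreducible : exists R : place iota, 0 < R w /\ 0 <= R v.
Proof.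
have [V [V_ring V_max]] := exists_maximal_nonunit_ring.
exact: maximal_ring_place V_ring V_max.
Qed.

End ExtendPlace.

Lemma val_ev_coprime (K L : fieldType) (iota : {rmorphism K -> L}) (v : L)
    (pi p : {poly K}) (R : place iota) :
  0 < R (ev iota v pi) -> 0 <= R v -> coprimep p pi -> R (ev iota v p) = 0.
Proof.
move=> hpi hv /Bezout_eq1_coprimepP[[a c] /= e].
have reg q : val_ge R 0 (ev iota v q) by apply: val_ge_ev; right.
have [->|p0] := eqVneq (ev iota v p) 0; first exact: val0.
have /(val_geE p0) := reg p; rewrite le_eqVlt => /orP[/eqP <- //|h].
suff : val_ge R 1 1 by move=> /(val_geE (oner_neq0 _)); rewrite val_one.
rewrite -[X in val_ge _ _ X](rmorph1 (ev iota v)) -e rmorphD !rmorphM /=.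
by apply: val_geD; rewrite -[X in val_ge _ X _]add0r; apply: val_geM => //; right; lia.
Qed.

(** * Arithmetic of [q], [m] and [M], Frobenius powers and roots of unity *)

Lemma prime_power_gt1 q : prime_power q -> (1 < q)%N.
Proof.
move=> [p [e [pp e0 ->]]]; rewrite -[1%N](expn0 p) ltn_exp2l //; exact: prime_gt1.
Qed.

Lemma BM_factorization q n : (1 < q)%N -> odd n ->
  exists2 M : nat, ((M * (q ^ 2 - q) + 1) * (q + 1) = q ^ n + 1)%N & (3 <= n -> 0 < M)%N.
Proof.
move=> q1 on; rewrite -(odd_double_half n) on /= add1n.
elim: (n./2) => [|k [M e _]]; first by exists 0%N => //; rewrite expn1; lia.
(* When [n] grows by [2], [M] becomes [q ^ 2 * M + 1], starting from [M = 0] at [n = 1]; it is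
   positive from [n = 3] on. *)
exists (q ^ 2 * M + 1)%N; last by lia.
have e1 : (q ^ (k.+1).*2.+1 = q ^ 2 * q ^ (k.*2.+1))%N by rewrite -expnD.
rewrite e1; nia.
Qed.

Lemma BM_mE q n : (1 < q)%N -> odd n ->
  [/\ BM_m q n * (q + 1) = q ^ n + 1, BM_m q n = BM_M q n * (q ^ 2 - q) + 1
    & (3 <= n -> 0 < BM_M q n)]%N.
Proof.
move=> q1 on; have [M e h] := BM_factorization q1 on.
have em : BM_m q n = (M * (q ^ 2 - q) + 1)%N by rewrite /BM_m -e mulnK // addn1.
have eM : BM_M q n = M by rewrite /BM_M em addnK mulnK //; nia.
by rewrite eM em.
Qed.

Section Frobenius.

Variables (q : nat) (K : fieldType) (q_char : [pchar K].-nat q).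
Variables (F : comNzRingType) (iota : {rmorphism K -> F}).

Lemma pnat_pchar_rmorph : [pchar F].-nat q.
Proof. by apply: sub_in_pnat q_char => p _; apply: rmorph_pchar. Qed.

Lemma exprDq (a b : F) : (a + b) ^+ q = a ^+ q + b ^+ q.
Proof. by rewrite exprDn_pchar // pnat_pchar_rmorph. Qed.

Hypothesis q_gt1 : (1 < q)%N.

Lemma exprNq (a : F) : (- a) ^+ q = - a ^+ q.
Proof.
apply/eqP; rewrite -addr_eq0 addrC -exprDq subrr expr0n.
by case: q q_gt1.
Qed.

Lemma natq0 : q%:R = 0 :> F.
Proof.
have hp : pdiv q \in [pchar F] by apply: (pnatPpi pnat_pchar_rmorph); rewrite pi_pdiv.
by apply/eqP; rewrite -(dvdn_pcharf hp) pdiv_dvd.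
Qed.

End Frobenius.

Lemma pnat_finField_pchar q n (K : finFieldType) :
  prime_power q -> #|K| = (q ^ n)%N -> [pchar K].-nat q.
Proof.
move=> [p [e [pp e0 eq]]] hK.
have hp : p \in [pchar K].
  by apply: (@card_finPcharP _ p (e * n)) => //; rewrite hK eq -expnM.
by rewrite eq pnatX (eq_pnat _ (pcharf_eq hp)) pnat_id.
Qed.

(** The nonzero elements of [K] form a cyclic group of order [q^(2n) - 1 = (q^n + 1) (q^n - 1)], and
    a power of a generator has order [q^n + 1]. *)
Lemma primitive_root_exists q n (K : finFieldType) : (1 < q)%N -> (0 < n)%N ->
  #|K| = (q ^ (2 * n))%N -> exists w : K, (q ^ n + 1).-primitive_root w.
Proof.
move=> q1 n0 hK.
have qn : (1 < q ^ n)%N by rewrite -[1%N](expn0 q) ltn_exp2l.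
have e : #|K|.-1 = ((q ^ n + 1) * (q ^ n - 1))%N.
  by rewrite hK mulnC expnM; nia.
have h : has #|K|.-1.-primitive_root (rem 0 (enum K)).
  apply: has_prim_root.
  - by rewrite e; nia.
  - apply/allP => a; rewrite mem_rem_uniq ?enum_uniq // inE => /andP[a0 _].
    rewrite unity_rootE; apply/eqP; apply: (mulfI a0).
    by rewrite -exprS prednK ?expf_card ?mulr1 //; apply/card_gt0P; exists 0.
  - by rewrite rem_uniq // enum_uniq.
  - by rewrite size_rem ?mem_enum // -cardE.
have /hasP[a _ ha] := h.
exists (a ^+ (#|K|.-1 %/ (q ^ n + 1))); apply: dvdn_prim_root => //.
by rewrite e dvdn_mulr.
Qed.

Lemma independent_below_mul n (d : int) : d != 0 -> independent_below n (n%:Z * d) d.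
Proof.
move=> d0 i i' j j' hi hi' e.
have {e} e : (n * j + i = n * j' + i')%N.
  suff : (n * j + i)%N%:Z = (n * j' + i')%N%:Z by lia.
  by apply: (mulfI d0); rewrite !PoszD !PoszM !mulrDr !(mulrCA d) !mulrA.
have ei : i = i' by have := congr1 (modn^~ n) e; rewrite /= !(mulnC n) !modnMDl !modn_small.
by split => //; subst i'; nia.
Qed.

Lemma val_ev_simple_zero (K L : fieldType) (iota : {rmorphism K -> L})
    (R : place iota) s (p : {poly K}) :
  0 < R s -> p`_0 = 0 -> p`_1 != 0 -> ev iota s p != 0 /\ R (ev iota s p) = R s.
Proof.
move=> Rs p0 p1.
have pn0 : p != 0 by apply: contraNneq p1 => ->; rewrite coef0.
have [|k [h1 h2 h3 h4]] := @val_ev _ _ _ R s p _ pn0; first by rewrite gt_eqF.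
split => //; rewrite h3; have := h4 1%N p1; rewrite ler_pM2l //.
by case: k h1 {h2 h3 h4} => [|[|k]] //; rewrite ?p0 ?eqxx ?mulr1.
Qed.

Lemma leq_of_pred_add (k i j : nat) :
  k.+1 = (i + j).-1 -> (1 < j)%N -> (i <= k)%N.
Proof. by lia. Qed.

(** With [n = q + 1], these are the values of [z ^ j * y ^ r * v ^ k] at a place above [x = 1], in
    units of the value of [z]. *)
Lemma mixed_radix_inj (m n j r k j' r' k' : nat) :
  (j < m)%N -> (r < n)%N -> (j' < m)%N -> (r' < n)%N ->
  (j + m * r + m * n * k = j' + m * r' + m * n * k')%N -> j = j' /\ r = r'.
Proof.
move=> hj hr hj' hr'; rewrite -!mulnA -!addnA -!mulnDr => e.
have ej : j = j'.
  have := congr1 (modn^~ m) e.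
  by rewrite /= !(addnC j) !(addnC j') !(mulnC m) !modnMDl !modn_small.
subst j'; split=> //; move/addnI: e => /eqP; rewrite eqn_pmul2l; last by lia.
move/eqP=> e; have := congr1 (modn^~ n) e.
by rewrite /= !(addnC r) !(addnC r') !(mulnC n) !modnMDl !modn_small.
Qed.

Lemma mixed_radix_lt (m n j r : nat) : (j < m)%N -> (r < n)%N -> (j + m * r < m * n)%N.
Proof.
by case: n => // n hj; rewrite ltnS mulnS -addSn => hr; rewrite leq_add // leq_mul.
Qed.

Lemma mixed_radix_int_inj (m n j r k j' r' : nat) (e : int) :
  (j < m)%N -> (r < n)%N -> (j' < m)%N -> (r' < n)%N ->
  (j + m * r + m * n * k)%N%:Z = j'%:Z + m%:Z * r'%:Z + (m * n)%N%:Z * e ->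
  [/\ j = j', r = r' & k%:Z = e].
Proof.
move=> hj hr hj' hr'; have lt := mixed_radix_lt hj' hr'; case: e => e h; last first.
  have : (m * n)%N%:Z * Negz e <= - (m * n)%N%:Z by rewrite NegzE; nia.
  lia.
have {}h : (j + m * r + m * n * k = j' + m * r' + m * n * e)%N by lia.
have [ej er] := mixed_radix_inj hj hr hj' hr' h; split=> //.
subst j' r'; move/addnI: h => /eqP; rewrite eqn_pmul2l; last by lia.
by move/eqP => ->.
Qed.

(** The closing computation of the lower bound: [s] is the power of [v] in the denominator of [f],
    [A] the power of [u + 1] that clears denominators, [B] the power of [u + 1] then divided out,
    and [PH2] the value at [P] of the quotient. *)
Lemma tau_arith (q m Pf Pzy PH2 k s A B ga l be k0 : int) :
  B = A - s + ga -> k0 = s + k -> Pf = Pzy + s * m ->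
  Pzy - q * m * A <= - (q * q - q) * be + (- (q * m) * B + PH2) ->
  PH2 <= - ((q + 1) * m) * k0 + - (q * m) * l ->
  Pf <= - (k * (m * (q + 1)) + (ga + l) * m * q + be * (q * q - q)).
Proof. by move=> -> -> -> h1 h2; nia. Qed.

(** Being [1] modulo [a], [b] is prime to [a], so [j] is determined modulo [b]. The pairs in use are
    [q ^ 2 - q] with [m], and [q] with [q + 1]. *)
Lemma coprime_weight_inj (a b M j c j' c' : nat) : b = (M * a + 1)%N ->
  (j < b)%N -> (j' < b)%N -> (a * j + b * c = a * j' + b * c')%N -> j = j'.
Proof.
move=> eb; wlog le : j c j' c' / (j <= j')%N.
  move=> h hj hj' e; have [le|lt] := leqP j j'; first exact: h le hj hj' e.
  by apply/esym; apply: h (ltnW lt) hj' hj (esym e).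
move=> hj hj' e.
have cop : coprime b a by rewrite eb coprime_sym /coprime gcdnMDl gcdn1.
have : (b %| a * (j' - j))%N.
  have -> : (a * (j' - j) = b * (c - c'))%N.
    have := leq_mul (leqnn a) le; rewrite !mulnBr; move: e.
    by move: (a * j)%N (a * j')%N (b * c)%N (b * c')%N => *; lia.
  exact: dvdn_mulr.
rewrite Gauss_dvdr // => dv; apply/eqP; rewrite eqn_leq le -subn_eq0.
rewrite -leqn0 leqNgt; apply/negP => /dvdn_leq/(_ dv).
by move: hj'; clear; lia.
Qed.

Lemma sum_mixed_radix (V : nmodType) (m n : nat) (F : nat -> V) :
  \sum_(e < m * n) F e = \sum_(j < m) \sum_(r < n) F (j + m * r)%N.
Proof.
elim: n => [|n IH].
  by rewrite muln0 big_ord0 big1 // => j _; rewrite big_ord0.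
rewrite mulnS addnC big_split_ord /= IH -big_split /=; apply: eq_bigr => j _.
by rewrite big_ord_recr /= [(m * n + j)%N]addnC.
Qed.

(** An explicit Bezout identity: as [m - M k = 1], the common factor is [rv - M rz]. *)
Lemma coprime_ratio (m M k : nat) (rz rv : int) : m = (M * k + 1)%N ->
  rz * m%:Z = k%:Z * rv ->
  rv = m%:Z * (rv - M%:Z * rz) /\ rz = k%:Z * (rv - M%:Z * rz).
Proof. by move=> -> e; split; nia. Qed.

Lemma tangent_weight_inj (a i j i' j' : nat) : (i < a.+1)%N -> (i' < a.+1)%N ->
  (a.+1 * j + a * i = a.+1 * j' + a * i')%N -> i = i' /\ j = j'.
Proof.
move=> hi hi' e.
have ei : i = i' by apply: (@coprime_weight_inj a a.+1 1 i j i' j') => //; lia.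
by split => //; subst i'; move/addIn: e => /eqP; rewrite eqn_pmul2l // => /eqP.
Qed.

(** [A], [W] and [E] will be the values of [pA], [pW] and [pi]. Multiplied by [m n], the left side
    is [(j + m r) A + n j W]. Both weights are at most [m n - 1] while [A + W <= E], and this
    missing unit makes the inequality strict. *)
Lemma ramified_weight_lt (m n j r : nat) (E X A W ry rz : int) :
  (j < m)%N -> (r < n)%N -> 0 < E -> E <= X -> 0 <= A -> 0 <= W -> A + W <= E ->
  ry * n%:Z = A -> rz * m%:Z = ry + W -> rz * j%:Z + ry * r%:Z < X.
Proof.
move=> hj hr E0 EX A0 W0 AWE ery erz; have n0 : (0 < n)%N by lia.
have lt1 : j%:Z + m%:Z * r%:Z <= m%:Z * n%:Z - 1.
  have : (j + m * r < m * n)%N by nia.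
  lia.
have lt2 : n%:Z * j%:Z <= m%:Z * n%:Z - 1 by nia.
have mn : 0 < m%:Z * n%:Z by nia.
rewrite -(ltr_pM2l mn); apply: le_lt_trans (_ : (m%:Z * n%:Z - 1) * E < _); last by nia.
have -> : m%:Z * n%:Z * (rz * j%:Z + ry * r%:Z) =
    (j%:Z + m%:Z * r%:Z) * A + (n%:Z * j%:Z) * W.
  have -> : m%:Z * n%:Z * (rz * j%:Z + ry * r%:Z) =
     n%:Z * j%:Z * (rz * m%:Z) + m%:Z * r%:Z * (ry * n%:Z) by ring.
  by rewrite erz -ery; ring.
apply: le_trans (_ : (m%:Z * n%:Z - 1) * (A + W) <= _); last first.
  by rewrite ler_wpM2l //; lia.
by rewrite mulrDr lerD // ler_wpM2r.
Qed.

(* The sum over the group of [n]-th roots of unity selects the terms whose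
   weight is [j] modulo [n]; no factor [1/n] appears when [n = 1] in [K]. *)
Lemma val_ge_average (K L : fieldType) (iota : {rmorphism K -> L}) (R : place iota)
    (I : finType) (f : I -> L) (e : I -> nat) n (w : K) a j :
  n.-primitive_root w -> n%:R = 1 :> K ->
  (forall k, val_ge R a (\sum_i iota (w ^+ (k * e i)) * f i)) ->
  val_ge R a (\sum_(i | e i == j %[mod n]) f i).
Proof.
move=> wp n1 h; have n0 := prim_order_gt0 wp.
have w0 : w != 0.
  apply: contraTneq isT => w0; have := prim_expr_order wp.
  by rewrite w0 expr0n gtn_eqF // => /eqP; rewrite eq_sym oner_eq0.
suff -> : \sum_(i | e i == j %[mod n]) f i =
    \sum_(k < n) iota (w^-1 ^+ (k * j)) * \sum_i iota (w ^+ (k * e i)) * f i.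
  apply: val_ge_sum => k _; rewrite -[a]add0r; apply: val_geM => //.
  exact: val_ge_cst.
under [RHS]eq_bigr do rewrite mulr_sumr.
rewrite exchange_big /= big_mkcond; apply: eq_bigr => i _.
pose c := w ^+ e i / w ^+ j.
have -> : \sum_(k < n) iota (w^-1 ^+ (k * j)) * (iota (w ^+ (k * e i)) * f i) =
    iota (\sum_(k < n) c ^+ k) * f i.
  rewrite rmorph_sum mulr_suml; apply: eq_bigr => k _ /=.
  rewrite mulrA -rmorphM; congr (iota _ * _).
  by rewrite /c exprMn -!exprVn !exprM [RHS]mulrC -!exprM ![(k * _)%N]mulnC.
have c1 : (c == 1) = (e i == j %[mod n]).
  rewrite -(eq_prim_root_expr wp) -subr_eq0 -[RHS]subr_eq0 /c.
  have -> : w ^+ e i / w ^+ j - 1 = (w ^+ e i - w ^+ j) / w ^+ j.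
    by field; rewrite expf_neq0.
  by rewrite mulf_eq0 invr_eq0 expf_eq0 (negbTE w0) andbF orbF.
rewrite -c1; case: eqP => [->|/eqP c1'].
  by under eq_bigr do rewrite expr1n; rewrite sumr_const card_ord n1 rmorph1 mul1r.
have : (c - 1) * (\sum_(k < n) c ^+ k) = 0.
  rewrite -subrX1 /c exprMn exprVn -!exprM mulnC [(j * _)%N]mulnC !exprM.
  by rewrite (prim_expr_order wp) !expr1n divr1 subrr.
move/eqP; rewrite mulf_eq0 subr_eq0 (negbTE c1') /= => /eqP ->.
by rewrite rmorph0 mul0r.
Qed.

(** * The Beelen-Montanucci function field *)

(* [v] stands for [x - 1], which vanishes at [Q] only, and [m * (q + 1)] is
   [q ^ n + 1]. *)
Section Curve.

Variables (q m M : nat).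
Hypotheses (q_gt1 : (1 < q)%N) (mM : m = (M * (q ^ 2 - q) + 1)%N).
Variables (K : fieldType) (w : K).
Hypotheses (q_char : [pchar K].-nat q) (w_prim : (m * (q + 1)).-primitive_root w).
Variables (L : fieldType) (iota : {rmorphism K -> L}) (v y z : L).
Hypothesis y_eq : y ^+ (q + 1) = (v + 1) ^+ (q + 1) - 1.
Hypothesis z_eq : z ^+ m =
  y * (((v + 1) ^+ (q ^ 2) - (v + 1)) / ((v + 1) ^+ (q + 1) - 1)).
Hypothesis L_gen : forall f, adjoin3 iota (v + 1) y z f.
Variables (Q P : place iota).
(** All that is kept of the coordinates of the two points. The poles of [x] and [y] cancel, at least
    in part, in [x + y] at [P], which singles it out among the places at infinity. *)
Hypotheses (Qv : 0 < Q v) (Pv : P v < 0) (Pt : P v < P (v + 1 + y)).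

Local Notation N := (m * (q + 1))%N.
Local Notation evv := (ev iota v).

Let m_gt0 : (0 < m)%N. Proof. by rewrite mM addn1. Qed.
Let N_gt0 : (0 < N)%N. Proof. by rewrite muln_gt0 m_gt0 addn1. Qed.
Let q2_gt0 : (0 < q ^ 2 - q)%N. Proof. by move: q_gt1; nia. Qed.

Let v_neq0 : v != 0.
Proof. by apply: contraTneq Qv => ->; rewrite val0. Qed.

Let ev_neq0 p : p != 0 -> evv p != 0.
Proof. by move=> p0; have [|k []//] := @val_ev _ _ _ Q v p _ p0; rewrite gt_eqF. Qed.

(* [x ^ (q+1) - 1], [(x ^ (q^2) - x) / (x ^ (q+1) - 1)] and [x ^ (q^2) - x], as
   polynomials in [v]. *)
Definition pA : {poly K} := 'X^(q + 1) + 'X^q + 'X.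
Definition pW : {poly K} := ('X + 1) * \sum_(k < q - 1) (('X + 1) ^+ (q + 1)) ^+ k.
Definition pS : {poly K} := 'X^(q ^ 2) - 'X.

Let XD1q : ('X + 1) ^+ q = 'X^q + 1 :> {poly K}.
Proof. by rewrite (exprDq q_char (polyC : {rmorphism K -> {poly K}})) expr1n. Qed.

Let pA_E : pA = ('X + 1) ^+ (q + 1) - 1.
Proof. by rewrite exprD XD1q expr1 /pA exprD expr1; ring. Qed.

Lemma pA_mul_pW : pA * pW = pS.
Proof.
rewrite /pW mulrCA pA_E -subrX1 -exprM mulrBr mulr1 -exprS.
have -> : ((q + 1) * (q - 1)).+1 = (q * q)%N by move: q_gt1; nia.
rewrite exprM XD1q (exprDq q_char (polyC : {rmorphism K -> {poly K}})) expr1n.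
by rewrite -exprM mulnn /pS opprD addrACA subrr addr0.
Qed.

Let size_pA : size pA = (q + 2)%N.
Proof.
rewrite /pA -addrA size_polyDl size_polyXn ?addn2 ?addn1 //.
by rewrite size_polyDl ?size_polyXn ?size_polyX // ltnS.
Qed.

Let size_pS : size pS = (q ^ 2).+1.
Proof.
rewrite /pS size_polyDl ?size_polyXn // size_polyN size_polyX.
by move: q_gt1; nia.
Qed.

Let pA_neq0 : pA != 0. Proof. by rewrite -size_poly_gt0 size_pA addn2. Qed.
Let pS_neq0 : pS != 0. Proof. by rewrite -size_poly_gt0 size_pS. Qed.
Let pW_neq0 : pW != 0.
Proof. by apply: contraNneq pS_neq0 => h; rewrite -pA_mul_pW h mulr0. Qed.

Let size_pW : size pW = (q ^ 2 - q)%N.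
Proof.
have := congr1 (fun p : {poly K} => size p) pA_mul_pW.
have : (q <= q ^ 2)%N by move: q_gt1; nia.
rewrite /= size_mul // size_pS size_pA; set a := size pW; lia.
Qed.

Let ev_pA : evv pA = (v + 1) ^+ (q + 1) - 1.
Proof. by rewrite pA_E rmorphB rmorphXn rmorphD /= evX rmorph1. Qed.

Let y_eqA : y ^+ (q + 1) = evv pA. Proof. by rewrite y_eq ev_pA. Qed.

Let ev_pS : evv pS = (v + 1) ^+ (q ^ 2) - (v + 1).
Proof.
rewrite rmorphB /= evXn evX -mulnn !exprM !(exprDq q_char iota) !expr1n.
by rewrite opprD addrACA subrr addr0.
Qed.

Let z_eqW : z ^+ m = y * evv pW.
Proof.
rewrite z_eq -ev_pS -ev_pA -pA_mul_pW rmorphM /= mulrAC divff ?mul1r //.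
exact: ev_neq0.
Qed.

Definition pG : {poly K} := pA * pW ^+ (q + 1).

Let z_eqG : z ^+ N = evv pG.
Proof. by rewrite exprM z_eqW exprMn y_eqA [RHS]rmorphM /= [in RHS]rmorphXn. Qed.

Let y_neq0 : y != 0.
Proof.
apply: contra_eq_neq y_eqA => ->; rewrite expr0n addn1 /= eq_sym.
exact: ev_neq0.
Qed.

Let z_neq0 : z != 0.
Proof.
apply: contra_eq_neq z_eqW => ->; rewrite expr0n gtn_eqF //= eq_sym.
by rewrite mulf_neq0 // ev_neq0.
Qed.

(** Total ramification: [pA] and [pS] have simple zeros at [0], so their quotient [pW] is a unit at
    [R], and the two equations of the curve give the ratios [1 : m : N]. *)
Lemma val_over_zero (R : place iota) : 0 < R v ->
  exists2 d : int, 0 < d & [/\ R z = d, R y = m%:Z * d & R v = N%:Z * d].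
Proof.
move=> Rv.
have [_ RA] : evv pA != 0 /\ R (evv pA) = R v.
  apply: val_ev_simple_zero => //; rewrite !coefD !coefXn coefX /=.
    by rewrite addn1 /=; case: q q_gt1 => //= *; rewrite !addr0.
  by rewrite addn1 eqSS; case: q q_gt1 => [|[]] //= *; rewrite !add0r oner_neq0.
have [_ RS] : evv pS != 0 /\ R (evv pS) = R v.
  apply: val_ev_simple_zero => //; rewrite coefB !coefXn coefX /=.
    by case: q q_gt1 => //= *; rewrite subrr.
  by rewrite ltn_eqF ?sub0r ?oppr_eq0 ?oner_neq0 //; move: q_gt1; nia.
have RW : R (evv pW) = 0.
  by move: RS; rewrite -pA_mul_pW rmorphM valM ?ev_neq0 //= RA; lia.
have Ry : R y * (q + 1)%N%:Z = R v by rewrite -valX y_eqA.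
have Rz : R z * m%:Z = R y by rewrite -valX z_eqW valM ?ev_neq0 // RW addr0.
exists (R z); last by split => //; lia.
rewrite -(pmulr_lgt0 _ (_ : 0 < m%:Z)) // Rz.
by rewrite -(pmulr_lgt0 _ (_ : 0 < (q + 1)%N%:Z)) ?Ry // addn1.
Qed.

Let indep_over_zero (R : place iota) : 0 < R v -> independent_below N (R v) (R z).
Proof.
by move=> /val_over_zero[d d0 [-> _ ->]]; apply: independent_below_mul; rewrite gt_eqF.
Qed.

(** The values at [Q] of the powers of [z] below [N] are distinct modulo that of [v]. This replaces
    a proof that the equation of [z] over [K(v)] is irreducible. *)
Let powers_z_free (T : {poly {poly K}}) :
  T != 0 -> (size T <= N)%N -> ev2 iota v z T != 0.
Proof.
by move=> T0 sT; have [i [j []]] := val_ev2 v_neq0 z_neq0 T0 sT (indep_over_zero Qv).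
Qed.

Definition pM : {poly {poly K}} := 'X^N - pG%:P.

Let size_pM : size pM = N.+1. Proof. exact: size_XnsubC. Qed.
Let monic_pM : pM \is monic. Proof. exact: monicXnsubC. Qed.
Let ev_pM : ev2 iota v z pM = 0.
Proof.
by rewrite ev2B rmorphXn /= ev2X ev2C z_eqG subrr.
Qed.

(** The resultant of [pM] and [T] is a combination of both, hence a multiple of [T] at [z]. It is
    not zero: a nonconstant common factor does not vanish at [z], as it divides a multiple of [T],
    so its cofactor in a multiple of [pM] would vanish there with degree below [N]. *)
Let ev2_inv (T : {poly {poly K}}) : ev2 iota v z T != 0 ->
  exists d S, d != 0 /\ ev2 iota v z T * ev2 iota v z S = evv d.
Proof.
move=> T0; have Tn0 : T != 0 by apply: contraNneq T0 => ->; rewrite rmorph0.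
have [s1|s1] := leqP (size T) 1.
  exists T`_0, 1; rewrite rmorph1 mulr1 {2}(size1_polyC s1) ev2C; split => //.
  by apply: contraNneq Tn0 => h; rewrite (size1_polyC s1) h.
have sM1 : (1 < size pM)%N by rewrite size_pM ltnS.
have [[a c] /= [_ _ e]] := resultant_in_ideal sM1 s1.
have r0 : resultant pM T != 0.
  rewrite resultant_eq0 -leqNgt; rewrite leqNgt; apply/negP => sg.
  set g := gcdp pM T in sg.
  have g0 : g != 0 by rewrite gcdp_eq0 negb_and Tn0 orbT.
  have [[c1 S1] /= c10 e1] := Pdiv.Idomain.dvdpP _ _ (dvdp_gcdl pM T).
  have [[c2 S2] /= c20 e2] := Pdiv.Idomain.dvdpP _ _ (dvdp_gcdr pM T).
  have evg : ev2 iota v z g != 0.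
    have : ev2 iota v z (c2 *: T) != 0.
      by rewrite -mul_polyC rmorphM /= ev2C mulf_neq0 // ev_neq0.
    by apply: contraNneq => hg; rewrite e2 rmorphM /= -/g hg mulr0.
  have S10 : S1 != 0.
    apply: contraTneq isT => S10; move/eqP: e1.
    rewrite S10 mul0r -mul_polyC mulf_eq0 polyC_eq0 (negbTE c10).
    by rewrite (negbTE (monic_neq0 monic_pM)).
  have : ev2 iota v z (c1 *: pM) != 0.
    rewrite e1 rmorphM /= mulf_neq0 //; apply: powers_z_free => //.
    have := congr1 (fun p : {poly {poly K}} => size p) e1.
    rewrite /= size_scale // size_pM size_mul // => es.
    exact: leq_of_pred_add es sg.
  by rewrite -mul_polyC rmorphM /= ev_pM mulr0 eqxx.
exists (resultant pM T), c; split => //.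
by rewrite -(ev2C iota v z) e rmorphD !rmorphM /= ev_pM mulr0 add0r mulrC.
Qed.

Let ev2_reduce_z (T : {poly {poly K}}) :
  exists2 T' : {poly {poly K}}, (size T' <= N)%N & ev2 iota v z T = ev2 iota v z T'.
Proof.
have [T' sT' eT'] := ev2_reduce T monic_pM ev_pM.
by exists T'; rewrite // -ltnS -size_pM.
Qed.

Lemma function_field_fraction f : exists (d : {poly K}) (T : {poly {poly K}}),
  [/\ d != 0, (size T <= N)%N & f = ev2 iota v z T / evv d].
Proof.
suff [d [T [d0 ->]]] : exists (d : {poly K}) (T : {poly {poly K}}),
    d != 0 /\ f = ev2 iota v z T / evv d.
  by have [T' sT' ->] := ev2_reduce_z T; exists d, T'.
elim: (L_gen f) => [c||||g h _ [d [T [d0 ->]]] _ [d' [T' [d'0 ->]]]|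
  g h _ [d [T [d0 ->]]] _ [d' [T' [d'0 ->]]]].
- by exists 1, c%:P%:P; rewrite oner_neq0 rmorph1 divr1 ev2C evC.
- by exists 1, ('X + 1)%:P; rewrite oner_neq0 rmorph1 divr1 ev2C rmorphD /= evX rmorph1.
- exists pW, 'X^m; rewrite pW_neq0 rmorphXn /= ev2X z_eqW mulfK //.
  exact: ev_neq0.
- by exists 1, 'X; rewrite oner_neq0 rmorph1 divr1 ev2X.
- exists (d * d'), (T * d'%:P - T' * d%:P); rewrite mulf_neq0 //.
  rewrite ev2B !rmorphM /= !ev2C; split => //.
  by field; rewrite !ev_neq0.
- have [T'0|T'0] := eqVneq (ev2 iota v z T') 0.
    by exists 1, 0; rewrite oner_neq0 T'0 rmorph0 !mul0r invr0 mulr0.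
  have [e [S [e0 eS]]] := ev2_inv T'0.
  exists (d * e), (T * S * d'%:P); rewrite mulf_neq0 //.
  rewrite !rmorphM /= ev2C; split => //.
  have S0 : ev2 iota v z S != 0.
    by apply: contraTneq (ev_neq0 e0) => S0; rewrite -eS S0 mulr0 eqxx.
  by rewrite -eS; field; rewrite !ev_neq0 ?T'0 ?S0.
Qed.

(* Cayley-Hamilton for the multiplication by [f] on the basis [z ^ j]. *)
Let bounded_degree f : exists T : {poly {poly K}},
  [/\ T != 0, (size T <= N.+1)%N & ev2 iota v f T = 0].
Proof.
have [d [p [d0 sp ef]]] := function_field_fraction f.
have /boolp.choice[r hr] : forall j, exists T' : {poly {poly K}},
    (size T' <= N)%N /\ ev2 iota v z (p * 'X^j) = ev2 iota v z T'.
  by move=> j; have [T' ? ?] := ev2_reduce_z (p * 'X^j); exists T'.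
pose A : 'M[{poly K}]_N := \matrix_(i, j) (r j)`_i.
pose chi := char_poly A.
have chi0 : (map_poly evv chi).[ev2 iota v z p] = 0.
  apply/eqP; rewrite map_char_poly -[_ == 0]/(root _ _) -eigenvalue_root_char.
  apply/eigenvalueP; exists (\row_j z ^+ j).
    apply/rowP => j; rewrite !mxE; have [sr er] := hr j.
    have -> : ev2 iota v z p * z ^+ j = ev2 iota v z (p * 'X^j).
      by rewrite rmorphM rmorphXn /= ev2X.
    rewrite er (ev2E _ _ _ sr); apply: eq_bigr => i _.
    by rewrite !mxE mulrC.
  apply/eqP => /rowP /(_ (Ordinal N_gt0)); rewrite !mxE expr0.
  by apply/eqP; rewrite oner_neq0.
have s_chi : size chi = N.+1 by rewrite size_char_poly.
exists (\poly_(i < N.+1) (chi`_i * d ^+ i)); split; last 1 first.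
- rewrite (ev2E _ _ _ (size_poly _ _)) -[RHS]chi0.
  rewrite (@horner_coef_wide _ N.+1) ?(leq_trans (size_poly _ _)) ?s_chi //.
  apply: eq_bigr => i _; rewrite coef_map coef_poly ltn_ord rmorphM rmorphXn /=.
  by rewrite -mulrA -exprMn ef mulrCA divff ?mulr1 // ev_neq0.
- apply: contraTneq (expf_neq0 N d0) => /(congr1 (fun p : {poly {poly K}} => p`_N)).
  rewrite coef_poly ltnSn coef0 (_ : chi`_N = 1) ?mul1r => [->|]; first by rewrite eqxx.
  by have := char_poly_monic A; rewrite monicE lead_coefE -/chi s_chi => /eqP.
- exact: size_poly.
Qed.

Lemma place_over (pi : {poly K}) : irreducible_poly pi ->
  exists R : place iota, 0 < R (evv pi) /\ 0 <= R v.
Proof. by move=> hpi; apply: (place_over_irreducible ev_neq0 bounded_degree). Qed.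

(** * Places above x = 1 *)

(** In this basis the components of a function regular outside [Q] and [P] have only powers of [v]
    as denominators. The powers of [z] would bring in [pW], as [y = z ^ m / pW]. *)
Definition zy_sum (c : 'I_m -> 'I_(q + 1) -> {poly K}) :=
  \sum_(j < m) \sum_(r < q + 1) z ^+ j * y ^+ r * evv (c j r).

Let ev2_z_zy (T : {poly {poly K}}) : (size T <= N)%N ->
  ev2 iota v z T = zy_sum (fun (j : 'I_m) (r : 'I_(q + 1)) => T`_(j + m * r)%N * pW ^+ r).
Proof.
move=> sT; rewrite (ev2E _ _ _ sT) (sum_mixed_radix m (q + 1) (fun e => evv T`_e * z ^+ e)).
apply: eq_bigr => j _; apply: eq_bigr => r _.
by rewrite rmorphM rmorphXn /= exprD exprM z_eqW exprMn; ring.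
Qed.

Lemma zy_fraction f : exists (d : {poly K}) c, d != 0 /\ f = zy_sum c / evv d.
Proof.
have [d [T [d0 sT ->]]] := function_field_fraction f.
by exists d; eexists; rewrite d0 (ev2_z_zy sT).
Qed.

Let zy_term (c : 'I_m -> 'I_(q + 1) -> {poly K}) (jr : 'I_m * 'I_(q + 1)) :=
  z ^+ jr.1 * y ^+ jr.2 * evv (c jr.1 jr.2).

Let zy_sumE c : zy_sum c = \sum_jr zy_term c jr.
Proof. by rewrite /zy_sum pair_bigA. Qed.

Let zy_term_neq0 c jr : (zy_term c jr != 0) = (c jr.1 jr.2 != 0).
Proof.
rewrite !mulf_eq0 !expf_eq0 (negbTE z_neq0) (negbTE y_neq0) !andbF /=.
by apply/idP/idP; [apply: contraNneq => ->; rewrite rmorph0|apply: ev_neq0].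
Qed.

Lemma val_zy_term (R : place iota) c jr : 0 < R v -> c jr.1 jr.2 != 0 ->
  exists k : nat, R (zy_term c jr) = R z * (jr.1 + m * jr.2 + N * k)%N%:Z.
Proof.
move=> Rv c0; have [d d0 [Rz Ry Rv']] := val_over_zero Rv.
have [|k [_ _ e _]] := @val_ev _ _ iota R v _ _ c0; first by rewrite gt_eqF.
exists k; rewrite !valM ?mulf_neq0 ?expf_neq0 ?ev_neq0 // !valX e Rz Ry Rv'.
by rewrite !PoszD !PoszM; ring.
Qed.

Let zy_term_inj (R : place iota) c : 0 < R v -> forall jr jr',
  zy_term c jr != 0 -> zy_term c jr' != 0 ->
  R (zy_term c jr) = R (zy_term c jr') -> jr = jr'.
Proof.
move=> Rv [j r] [j' r']; rewrite !zy_term_neq0 => c0 c0'.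
have [k ->] := val_zy_term Rv c0; have [k' ->] := val_zy_term Rv c0'.
have [d d0 [-> _ _]] := val_over_zero Rv.
have dn0 : d != 0 by rewrite gt_eqF.
move/(mulfI dn0) => [/= e].
have [e1 e2] := mixed_radix_inj (ltn_ord j) (ltn_ord r) (ltn_ord j') (ltn_ord r') e.
by rewrite (val_inj e1) (val_inj e2).
Qed.

Lemma val_zy_sum (R : place iota) c : 0 < R v -> zy_sum c != 0 ->
  exists jr (k : nat), [/\ c jr.1 jr.2 != 0, R (zy_sum c) = R (zy_term c jr),
    R (zy_sum c) = R z * (jr.1 + m * jr.2 + N * k)%N%:Z &
    forall jr', c jr'.1 jr'.2 != 0 -> R (zy_sum c) <= R (zy_term c jr')].
Proof.
move=> Rv; rewrite zy_sumE => s0.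
have ex : exists jr, zy_term c jr != 0.
  apply: contrapT => nex; move/eqP: s0; apply; apply: big1 => jr _.
  by apply/eqP; rewrite -[_ == _]negbK; apply/negP => h; apply: nex; exists jr.
have [jr [h1 h2 h3 h4]] := val_sum_distinct ex (zy_term_inj Rv (c := c)).
rewrite zy_term_neq0 in h1; have [k ek] := val_zy_term Rv h1.
exists jr, k; rewrite h4; split=> // jr' hjr'.
by apply: h2; rewrite zy_term_neq0.
Qed.

Lemma zy_sum_neq0 c jr : c jr.1 jr.2 != 0 -> zy_sum c != 0.
Proof.
move=> c0; rewrite zy_sumE.
have ex : exists jr, zy_term c jr != 0 by exists jr; rewrite zy_term_neq0.
by have [i [_ _ h _]] := val_sum_distinct ex (zy_term_inj Qv (c := c)).
Qed.

(** Functions are quotients of a [zy_sum] by a polynomial in [v], so every value is a multiple of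
    that of [z]; but some value is [1]. *)
Lemma val_z_over_zero (R : place iota) : 0 < R v -> R z = 1.
Proof.
move=> Rv; have [f f0 Rf] := val_unif R.
have [d [c [d0 ef]]] := zy_fraction f.
have s0 : zy_sum c != 0 by apply: contraNneq f0; rewrite ef => ->; rewrite mul0r.
have [jr [k [_ _ e _]]] := val_zy_sum Rv s0.
have [|k' [_ _ e' _]] := @val_ev _ _ iota R v _ _ d0; first by rewrite gt_eqF.
have [D D0 [Rz _ Rv']] := val_over_zero Rv.
have : (R z %| R f)%Z.
  rewrite ef valM ?invr_neq0 ?ev_neq0 // valV e e' Rv' -Rz.
  rewrite -mulrA [_%:Z * (R z * _)]mulrCA -mulrBr; exact: dvdz_mulr.
by rewrite Rf dvdz1 Rz; move: D0; clear; lia.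
Qed.

Lemma val_ev_agree (R R' : place iota) p : R v != 0 -> R' v = R v ->
  R' (evv p) = R (evv p).
Proof.
move=> Rv e; rewrite -(ev2C iota v v).
apply: (@val_ev2_agree _ _ _ R R' v v _ 1%N) => //; first exact: size_polyC_leq1.
move=> i i' j j'; rewrite !ltnS !leqn0 => /eqP-> /eqP->; rewrite !mulr0 !addr0.
by move/(mulfI Rv) => [->].
Qed.

(** The values of [v], [y] and [z] are now forced, and numerators and denominators are sums of
    monomials in them of distinct values. *)
Lemma place_over_zero_unique (R R' : place iota) : 0 < R v -> 0 < R' v -> R' =1 R.
Proof.
move=> Rv Rv' f; have [d [c [d0 ->]]] := zy_fraction f.
have [D D0 [Rz Ry Rve]] := val_over_zero Rv.
have [D' D0' [Rz' Ry' Rve']] := val_over_zero Rv'.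
have eD : D' = D by rewrite -Rz -Rz' !val_z_over_zero.
have ez : R' z = R z by rewrite Rz' Rz eD.
have ey : R' y = R y by rewrite Ry' Ry eD.
have ev' : R' v = R v by rewrite Rve' Rve eD.
have Rv0 : R v != 0 by rewrite gt_eqF.
have es : R' (zy_sum c) = R (zy_sum c).
  rewrite zy_sumE; apply: val_sum_agree; first exact: zy_term_inj.
  move=> jr; rewrite zy_term_neq0 => c0.
  rewrite !valM ?mulf_neq0 ?expf_neq0 ?ev_neq0 // !valX ez ey.
  by rewrite (val_ev_agree _ Rv0 ev').
have [->|s0] := eqVneq (zy_sum c) 0; first by rewrite mul0r !val0.
by rewrite !valM ?invr_neq0 ?ev_neq0 // !valV es (val_ev_agree _ Rv0 ev').
Qed.

(** * Places at infinity *)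

Local Notation t := (v + 1 + y).
Local Notation b := (v / t).
Local Notation u := (t^-1 - 1).

Let t_neq0 : t != 0.
Proof.
rewrite addr_eq0; apply: contra_eq_neq y_eq => e.
have -> : y = - (v + 1) by rewrite e opprK.
rewrite addn1 !exprSr (exprNq q_char iota q_gt1) mulrNN eq_sym -subr_eq0.
by rewrite addrAC subrr sub0r oppr_eq0 oner_neq0.
Qed.

Let b_neq0 : b != 0. Proof. by rewrite mulf_neq0 ?invr_neq0. Qed.

Let uD1 : u + 1 = t^-1. Proof. by rewrite subrK. Qed.

(* Moving the tangent line [x + y = 0] at [P] to infinity. *)
Lemma hermitian_normal_form : u ^+ (q + 1) = b ^+ q + b.
Proof.
have tq : t ^+ q = v ^+ q + 1 + y ^+ q by rewrite !(exprDq q_char iota) expr1n.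
have yq : y ^+ q * y = (v ^+ q + 1) * (v + 1) - 1.
  by rewrite -exprSr -addn1 y_eq addn1 exprSr (exprDq q_char iota) expr1n.
rewrite addn1 exprSr (exprDq q_char iota) (exprNq q_char iota q_gt1) expr1n.
rewrite exprMn exprVn.
have tq0 : t ^+ q != 0 by rewrite expf_neq0.
apply: (mulfI (mulf_neq0 tq0 t_neq0)).
have -> : t ^+ q * t * (((t ^+ q)^-1 - 1) * (t^-1 - 1)) = (1 - t ^+ q) * (1 - t).
  by field; rewrite tq0 t_neq0.
have -> : t ^+ q * t * (v ^+ q * (t ^+ q)^-1 + v / t) = v ^+ q * t + t ^+ q * v.
  by field; rewrite tq0 t_neq0.
have -> : (1 - t ^+ q) * (1 - t) =
    v ^+ q * v + v ^+ q * y + y ^+ q * v + y ^+ q * y by rewrite tq; ring.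
by rewrite yq tq; ring.
Qed.

Let u_neq0 : u != 0.
Proof.
(* [u = 0] would force [b ^ (q-1) = -1], but [b] vanishes at [Q] *)
apply/eqP => u0; have := hermitian_normal_form; rewrite u0 expr0n addn1 /=.
have tQ : t = 1 by move/eqP: u0; rewrite subr_eq0 invr_eq1 => /eqP.
have bv : b = v by rewrite tQ divr1.
rewrite bv => /esym e.
have [] := @val_addl_lt _ _ _ Q v (v ^+ q) v_neq0.
  by rewrite valX ltr_pMr // ltz_nat.
by rewrite addrC e eqxx.
Qed.

Lemma val_at_infinity (R : place iota) : R v < 0 ->
  R y = R v /\ R z * m%:Z = (q ^ 2 - q)%N%:Z * R v.
Proof.
move=> Rv; have [_ RA] := val_ev_lt0 Rv pA_neq0; have [_ RW] := val_ev_lt0 Rv pW_neq0.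
have Ry : R y = R v.
  have q1n0 : (q + 1)%N%:Z != 0 by rewrite addn1.
  by apply: (mulIf q1n0); rewrite -valX y_eqA RA size_pA addn2 addn1.
split => //; rewrite -valX z_eqW valM ?ev_neq0 // RW Ry size_pW.
have -> : (q ^ 2 - q)%N%:Z = 1 + (q ^ 2 - q).-1%:Z by move: q2_gt0; clear; lia.
by rewrite mulrDl mul1r mulrC.
Qed.

(** [b] has a pole because [v] has a smaller value than [t], and the normal form makes the pole
    orders of [u] and [b] proportional to [q] and [q + 1]. Then [u + 1 = 1 / t] gives the value of
    [t], and the coprimality of [m] and [q ^ 2 - q] the common factor [d]. *)
Lemma val_at_tangent (R : place iota) : R v < 0 -> R v < R t ->
  exists2 d : int, 0 < d & [/\ R v = - (m%:Z * d), R t = (q * m)%N%:Z * d,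
    R b = - ((q.+1 * m)%N%:Z * d), R u = - ((q * m)%N%:Z * d) &
    R z = - ((q ^ 2 - q)%N%:Z * d)].
Proof.
move=> Rv Rt; have [_ Rz] := val_at_infinity Rv.
have Rb : R b = R v - R t by rewrite valM ?invr_neq0 // valV.
have Rb0 : R b < 0 by rewrite Rb subr_lt0.
have Ru : R u * (q + 1)%N%:Z = R b * q%:Z.
  rewrite -valX hermitian_normal_form -valX.
  have [|_ -> //] := @val_addl_lt _ _ _ R (b ^+ q) b (expf_neq0 _ b_neq0).
  by rewrite valX gtr_nMr // ltz_nat.
have Ru0 : R u < 0 by move: Ru Rb0 q_gt1; clear; nia.
have Ru1 : - R t = R u.
  rewrite -valV -[in LHS]uD1; have [|_ -> //] := @val_addl_lt _ _ _ R u 1 u_neq0.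
  by rewrite val_one.
have [e1 e2] := coprime_ratio mM Rz.
exists (- (R v - M%:Z * R z)).
  by move: e1 Rv m_gt0; clear; nia.
have eRt : R t = - q%:Z * R v by move: Ru Ru1 Rb; clear; nia.
split; rewrite ?mulrN ?opprK //.
- by rewrite PoszM -mulrA -e1 eRt mulNr.
- by rewrite PoszM -mulrA -e1 Rb eRt; clear; lia.
- by rewrite PoszM -mulrA -e1 -Ru1 eRt; clear; lia.
Qed.

(** The affine coordinate ring [K[b, u]] of the Hermitian curve after the tangent line below [P] is
    moved to infinity. *)
Definition bu_poly f := exists T : {poly {poly K}}, f = ev2 iota b u T.

Let bu_cst c : bu_poly (iota c).
Proof. by exists c%:P%:P; rewrite ev2C evC. Qed.
Let bu_b : bu_poly b. Proof. by exists 'X%:P; rewrite ev2C evX. Qed.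
Let bu_u : bu_poly u. Proof. by exists 'X; rewrite ev2X. Qed.
Let bu_D f g : bu_poly f -> bu_poly g -> bu_poly (f + g).
Proof. by move=> [T ->] [T' ->]; exists (T + T'); rewrite rmorphD. Qed.
Let bu_M f g : bu_poly f -> bu_poly g -> bu_poly (f * g).
Proof. by move=> [T ->] [T' ->]; exists (T * T'); rewrite rmorphM. Qed.
Let bu_1 : bu_poly 1. Proof. by rewrite -(rmorph1 iota). Qed.
Let bu_N f : bu_poly f -> bu_poly (- f).
Proof. by move=> h; rewrite -mulN1r -(rmorphN1 iota); apply: bu_M. Qed.
Let bu_X f n : bu_poly f -> bu_poly (f ^+ n).
Proof. by move=> h; elim: n => [|n IH]; rewrite ?expr0 // exprS; apply: bu_M. Qed.
Let bu_u1 : bu_poly (u + 1). Proof. exact: bu_D. Qed.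

Let bu_reduce f : bu_poly f ->
  exists2 T : {poly {poly K}}, (size T <= q.+1)%N & f = ev2 iota b u T.
Proof.
move=> [T ->]; pose H : {poly {poly K}} := 'X^(q.+1) - ('X^q + 'X)%:P.
have H0 : ev2 iota b u H = 0.
  rewrite ev2B rmorphXn /= ev2X ev2C rmorphD /= evXn evX.
  by rewrite -addn1 hermitian_normal_form subrr.
have [T' sT' eT'] := ev2_reduce T (monicXnsubC ('X^q + 'X) (ltn0Sn q)) H0.
by exists T' => //; rewrite -ltnS (leq_trans sT') // size_XnsubC.
Qed.

(* Since [v = b / (u + 1)] and [y = - (u + b) / (u + 1)], a high power of
   [u + 1] clears the denominators of any polynomial in [v] and [y]. *)
Let bu_after f := exists A0 : nat, forall A, (A0 <= A)%N -> bu_poly (f * (u + 1) ^+ A).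

Let after_cst c : bu_after (iota c).
Proof. by exists 0 => A _; apply: bu_M; [|apply: bu_X]. Qed.

Let after_D f g : bu_after f -> bu_after g -> bu_after (f + g).
Proof.
move=> [A hA] [B hB]; exists (maxn A B) => C; rewrite geq_max => /andP[h1 h2].
by rewrite mulrDl; apply: bu_D; [apply: hA|apply: hB].
Qed.

Let after_M f g : bu_after f -> bu_after g -> bu_after (f * g).
Proof.
move=> [A hA] [B hB]; exists (A + B)%N => C hC.
have -> : f * g * (u + 1) ^+ C = (f * (u + 1) ^+ A) * (g * (u + 1) ^+ (C - A)).
  rewrite mulrACA -exprD subnKC //; exact: leq_trans (leq_addr _ _) hC.
by apply: bu_M; [apply: hA|apply: hB; rewrite leq_subRL ?(leq_trans (leq_addr _ _) hC)].
Qed.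

Let after_div1 f : bu_poly (f * (u + 1)) -> bu_after f.
Proof.
move=> h; exists 1%N => -[//|A] _; rewrite exprS mulrA.
by apply: bu_M => //; apply: bu_X.
Qed.

Let after_v : bu_after v.
Proof. by apply: after_div1; rewrite uD1. Qed.

Let after_y : bu_after y.
Proof.
apply: after_div1.
have -> : y * (u + 1) = - u - b by rewrite uD1; field.
by apply: bu_D; apply: bu_N.
Qed.

Let after_ev p : bu_after (evv p).
Proof.
elim/poly_ind: p => [|p c IH]; first by rewrite rmorph0 -(rmorph0 iota).
by rewrite rmorphD rmorphM /= evX evC; apply: after_D => //; apply: after_M.
Qed.

Let after_X f n : bu_after f -> bu_after (f ^+ n).
Proof.
move=> h; elim: n => [|n IH]; first by rewrite expr0 -(rmorph1 iota).
by rewrite exprS; apply: after_M.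
Qed.

Let after_row (c : 'I_(q + 1) -> {poly K}) : bu_after (\sum_(r < q + 1) y ^+ r * evv (c r)).
Proof.
elim/big_ind: _ => [|f g|r _]; first by rewrite -(rmorph0 iota).
  exact: after_D.
by apply: after_M; [apply: after_X|].
Qed.

(** One exponent serves all [j]. The bound [A1] will be the exponent of [v] in a denominator, so
    that subtracting it from [A] is not truncated. *)
Lemma zbu_fraction c A1 : exists (A : nat) (S : 'I_m -> {poly {poly K}}),
  (A1 <= A)%N /\ forall j, (size (S j) <= q.+1)%N /\
    (\sum_(r < q + 1) y ^+ r * evv (c j r)) * (u + 1) ^+ A = ev2 iota b u (S j).
Proof.
have /boolp.choice[A0 hA0] : forall j : 'I_m, bu_after (\sum_(r < q + 1) y ^+ r * evv (c j r)).
  by move=> j; apply: after_row.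
pose A := maxn (\max_j A0 j) A1.
have /boolp.choice[S hS] : forall j : 'I_m, exists T : {poly {poly K}},
    (size T <= q.+1)%N /\
    (\sum_(r < q + 1) y ^+ r * evv (c j r)) * (u + 1) ^+ A = ev2 iota b u T.
  move=> j; have [|T sT eT] := bu_reduce (hA0 j A _).
    by rewrite leq_max leq_bigmax.
  by exists T.
by exists A, S; rewrite leq_maxr.
Qed.

Lemma zy_sum_zbu c A (S : 'I_m -> {poly {poly K}}) :
  (forall j, (\sum_(r < q + 1) y ^+ r * evv (c j r)) * (u + 1) ^+ A =
    ev2 iota b u (S j)) ->
  zy_sum c * (u + 1) ^+ A = \sum_(j < m) z ^+ j * ev2 iota b u (S j).
Proof.
move=> hS; rewrite mulr_suml; apply: eq_bigr => j _; rewrite -hS mulrA mulr_sumr.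
by congr (_ * _); apply: eq_bigr => r _; rewrite mulrA.
Qed.

Let bu_indep (R : place iota) : R v < 0 -> R v < R t ->
  independent_below q.+1 (R b) (R u).
Proof.
move=> Rv Rt; have [d d0 [_ _ -> -> _]] := val_at_tangent Rv Rt.
have md : - (m%:Z * d) != 0.
  by rewrite oppr_eq0 mulf_eq0 negb_or gt_eqF // lt0r_neq0.
move=> i i' j j' hi hi' e; apply: (tangent_weight_inj hi hi').
apply/eqP; rewrite -eqz_nat; apply/eqP/(mulfI md).
by rewrite !PoszD !PoszM in e *; move: e; clear; lia.
Qed.

Lemma val_bu (R : place iota) (T : {poly {poly K}}) : R v < 0 -> R v < R t ->
    T != 0 -> (size T <= q.+1)%N ->
  ev2 iota b u T != 0 /\ exists k : nat, R (ev2 iota b u T) = R v * k%:Z.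
Proof.
move=> Rv Rt T0 sT.
have [i [j [_ _ n0 e _]]] := val_ev2 b_neq0 u_neq0 T0 sT (bu_indep Rv Rt).
split => //; exists (q.+1 * j + q * i)%N; rewrite e.
have [d d0 [-> _ -> -> _]] := val_at_tangent Rv Rt.
by rewrite !PoszD !PoszM; ring.
Qed.

(** Up to the factor [d], elements of [K[b, u]] have values divisible by [m] and the value of [z] is
    prime to [m], so the value modulo [m] determines [j]. *)
Let zbu_term_inj (R : place iota) (S : 'I_m -> {poly {poly K}}) :
  R v < 0 -> R v < R t -> (forall j, (size (S j) <= q.+1)%N) ->
  forall j j' : 'I_m,
  z ^+ j * ev2 iota b u (S j) != 0 -> z ^+ j' * ev2 iota b u (S j') != 0 ->
  R (z ^+ j * ev2 iota b u (S j)) = R (z ^+ j' * ev2 iota b u (S j')) -> j = j'.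
Proof.
move=> Rv Rt sS j j'; rewrite !mulf_eq0 !negb_or => /andP[zj0 Sj0] /andP[zj0' Sj0'].
have S0 (i : 'I_m) : ev2 iota b u (S i) != 0 -> S i != 0.
  by apply: contraNneq => ->; rewrite rmorph0.
have [_ [k ek]] := val_bu Rv Rt (S0 _ Sj0) (sS j).
have [_ [k' ek']] := val_bu Rv Rt (S0 _ Sj0') (sS j').
rewrite !valM // !valX ek ek'.
have [d d0 [-> _ _ _ ->]] := val_at_tangent Rv Rt.
have dn0 : - d != 0 by rewrite oppr_eq0 gt_eqF.
move=> e; apply: val_inj.
apply: (@coprime_weight_inj (q ^ 2 - q) m M j k j' k') => //.
apply/eqP; rewrite -eqz_nat; apply/eqP/(mulfI dn0).
by rewrite !PoszD !PoszM; move: e; clear; lia.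
Qed.

Lemma val_zbu (R : place iota) (S : 'I_m -> {poly {poly K}}) :
    R v < 0 -> R v < R t -> (forall j, (size (S j) <= q.+1)%N) ->
    \sum_(j < m) z ^+ j * ev2 iota b u (S j) != 0 ->
  (exists j : 'I_m, ev2 iota b u (S j) != 0 /\
    R (\sum_(j < m) z ^+ j * ev2 iota b u (S j)) = R (z ^+ j * ev2 iota b u (S j))) /\
  forall j : 'I_m, ev2 iota b u (S j) != 0 ->
    R (\sum_(j < m) z ^+ j * ev2 iota b u (S j)) <= R (z ^+ j * ev2 iota b u (S j)).
Proof.
move=> Rv Rt sS s0.
have ex : exists j : 'I_m, z ^+ j * ev2 iota b u (S j) != 0.
  apply: contrapT => nex; move/eqP: s0; apply; apply: big1 => j _.
  by apply/eqP; rewrite -[_ == _]negbK; apply/negP => h; apply: nex; exists j.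
have [j [h1 h2 h3 h4]] := val_sum_distinct ex (zbu_term_inj Rv Rt sS).
split.
  by exists j; split => //; move: h1; rewrite mulf_eq0 negb_or => /andP[].
by move=> i hi; rewrite h4 h2 // mulf_neq0 // expf_neq0.
Qed.

Let uD1_neq0 : u + 1 != 0. Proof. by rewrite uD1 invr_neq0. Qed.

Lemma val_at_tangent_norm (R : place iota) : R v < 0 -> R v < R t -> R v = - m%:Z.
Proof.
move=> Rv Rt; have [f f0 Rf] := val_unif R.
have [d [c [d0 ef]]] := zy_fraction f.
have [A [S [_ hS]]] := zbu_fraction c 0.
have eS := zy_sum_zbu (fun j => (hS j).2).
have [D D0 [Rve Rte _ _ Rz]] := val_at_tangent Rv Rt.
have s0 : zy_sum c != 0 by apply: contraNneq f0; rewrite ef => ->; rewrite mul0r.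
have zn0 : zy_sum c * (u + 1) ^+ A != 0 by rewrite mulf_neq0 ?expf_neq0.
rewrite eS in zn0.
have [[j [Sj0 ej]] _] := val_zbu Rv Rt (fun j => (hS j).1) zn0.
have Sn0 : S j != 0 by apply: contraNneq Sj0 => ->; rewrite rmorph0.
have [_ [k ek]] := val_bu Rv Rt Sn0 (hS j).1.
have [_ ed] := val_ev_lt0 Rv d0.
have e : R (zy_sum c) = R z * j%:Z + R v * k%:Z + R t * A%:Z.
  have : R (zy_sum c * (u + 1) ^+ A) = R (z ^+ j * ev2 iota b u (S j)) by rewrite eS.
  by rewrite !valM ?expf_neq0 // !valX uD1 valV ek mulNr => /eqP; rewrite subr_eq => /eqP.
have : (D %| R f)%Z.
  rewrite ef valM ?invr_neq0 ?ev_neq0 // valV ed e Rz Rve Rte.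
  apply/dvdzP; exists (- (q ^ 2 - q)%N%:Z * j%:Z - m%:Z * k%:Z + (q * m)%N%:Z * A%:Z
    + m%:Z * (size d).-1%:Z).
  by ring.
by rewrite Rf dvdz1 Rve; move: D0; clear; lia.
Qed.

Lemma val_at_tangent_eq (R : place iota) : R v < 0 -> R v < R t ->
  [/\ R v = - m%:Z, R t = (q * m)%N%:Z, R b = - (q.+1 * m)%N%:Z,
      R u = - (q * m)%N%:Z & R z = - (q ^ 2 - q)%N%:Z].
Proof.
move=> Rv Rt; have [d d0 [e1 -> -> -> ->]] := val_at_tangent Rv Rt.
have -> : d = 1.
  have := val_at_tangent_norm Rv Rt; rewrite e1 => /oppr_inj.
  by move: m_gt0; clear; nia.
by rewrite (val_at_tangent_norm Rv Rt) !mulr1.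
Qed.

Lemma place_at_tangent_unique (R R' : place iota) :
  R v < 0 -> R v < R t -> R' v < 0 -> R' v < R' t -> R' =1 R.
Proof.
move=> Rv Rt Rv' Rt' f; have [d [c [d0 ->]]] := zy_fraction f.
have [e1 e2 e3 e4 e5] := val_at_tangent_eq Rv Rt.
have [e1' e2' e3' e4' e5'] := val_at_tangent_eq Rv' Rt'.
have [A [S [_ hS]]] := zbu_fraction c 0.
have eS := zy_sum_zbu (fun j => (hS j).2).
have es : R' (zy_sum c * (u + 1) ^+ A) = R (zy_sum c * (u + 1) ^+ A).
  rewrite eS; apply: val_sum_agree.
    by apply: zbu_term_inj => // j; case: (hS j).
  move=> j; rewrite mulf_eq0 negb_or => /andP[zj0 Sj0].
  rewrite !valM // !valX e5 e5'; congr (_ + _).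
  by apply: (val_ev2_agree b_neq0 u_neq0 (hS j).1 (bu_indep Rv Rt)); rewrite ?e3 ?e4.
have [->|s0] := eqVneq (zy_sum c) 0; first by rewrite mul0r !val0.
move: es; rewrite !valM ?expf_neq0 ?invr_neq0 ?ev_neq0 // !valX uD1 !valV e2 e2'.
move/addIr ->; congr (_ - _).
by apply: val_ev_agree; [rewrite lt_eqF|rewrite e1 e1'].
Qed.

(** * Automorphisms *)

Let ev2_twist_eq0 (a : K) (T : {poly {poly K}}) : a ^+ N = 1 ->
  ev2 iota v z T = 0 -> ev2 iota v (iota a * z) T = 0.
Proof.
move=> aN T0; rewrite (Pdiv.RingMonic.rdivp_eq monic_pM T).
have sr : (size (Pdiv.Ring.rmodp T pM) <= N)%N.
  by rewrite -ltnS -size_pM Pdiv.Ring.ltn_rmodp monic_neq0.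
have -> : Pdiv.Ring.rmodp T pM = 0.
  apply/eqP; apply: contraT => r0; have := powers_z_free r0 sr.
  move: T0; rewrite {1}(Pdiv.RingMonic.rdivp_eq monic_pM T).
  by rewrite rmorphD rmorphM /= ev_pM mulr0 add0r => ->; rewrite eqxx.
rewrite addr0 rmorphM /= (_ : ev2 iota v _ pM = 0) ?mulr0 //.
by rewrite ev2B rmorphXn /= ev2X ev2C exprMn -rmorphXn aN rmorph1 mul1r z_eqG subrr.
Qed.

(** Substitute [a z] for [z] in fractions. This is well defined because a polynomial vanishing at
    [z] is a multiple of [pM], which also vanishes at [a z]. The action on [y] follows from
    [y = z ^ m / pW]. *)
Lemma twist_exists (a : K) : a ^+ N = 1 -> exists s : {rmorphism L -> L},
  [/\ forall c, s (iota c) = iota c, s v = v, s z = iota a * z & s y = iota (a ^+ m) * y].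
Proof.
move=> aN; pose z' := iota a * z.
have /boolp.choice[s hs] : forall f, exists g, forall (d : {poly K}) (T : {poly {poly K}}),
    d != 0 -> f = ev2 iota v z T / evv d -> g = ev2 iota v z' T / evv d.
  move=> f; have [d [T [d0 sT ef]]] := function_field_fraction f.
  exists (ev2 iota v z' T / evv d) => d' T' d0'; rewrite ef => /eqP.
  rewrite eqr_div ?ev_neq0 // -subr_eq0 -!(ev2C iota v z) -!rmorphM -ev2B => /eqP.
  move/(ev2_twist_eq0 aN); rewrite ev2B !rmorphM /= !ev2C => /eqP.
  by rewrite subr_eq0 -eqr_div ?ev_neq0 // => /eqP.
have s_frac d T : d != 0 -> s (ev2 iota v z T / evv d) = ev2 iota v z' T / evv d.
  by move=> d0; apply: hs.
have s_zmod : zmod_morphism s.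
  move=> f g; have [d [T [d0 _ ->]]] := function_field_fraction f.
  have [d' [T' [d0' _ ->]]] := function_field_fraction g.
  have e z1 : ev2 iota v z1 T / evv d - ev2 iota v z1 T' / evv d' =
      ev2 iota v z1 (T * d'%:P - T' * d%:P) / evv (d * d').
    by rewrite ev2B !rmorphM /= !ev2C; field; rewrite !ev_neq0.
  by rewrite e !s_frac ?mulf_neq0 // e.
have s_mon : monoid_morphism s.
  split.
    have -> : 1 = ev2 iota v z 1 / evv 1 by rewrite !rmorph1 divr1.
    by rewrite s_frac ?oner_neq0 // !rmorph1.
  move=> f g; have [d [T [d0 _ ->]]] := function_field_fraction f.
  have [d' [T' [d0' _ ->]]] := function_field_fraction g.
  have e z1 : ev2 iota v z1 T / evv d * (ev2 iota v z1 T' / evv d') =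
      ev2 iota v z1 (T * T') / evv (d * d').
    by rewrite !rmorphM /=; field; rewrite !ev_neq0.
  by rewrite e !s_frac ?mulf_neq0 // e.
pose sZ := GRing.isZmodMorphism.Build L L s s_zmod.
pose sM := GRing.isMonoidMorphism.Build L L s s_mon.
pose sR : {rmorphism L -> L} := HB.pack_for {rmorphism L -> L} s sZ sM.
have s_pol p : s (evv p) = evv p.
  have := s_frac 1 p%:P (oner_neq0 _); rewrite !ev2C rmorph1 !divr1; exact.
have s_z : s z = iota a * z.
  by have := s_frac 1 'X (oner_neq0 _); rewrite !ev2X rmorph1 !divr1.
exists sR; split => //=.
- by move=> c; rewrite -(evC iota v) s_pol.
- by rewrite -{1}(evX iota v) s_pol evX.
- have ey : y = ev2 iota v z 'X^m / evv pW.
    by rewrite rmorphXn /= ev2X z_eqW mulfK // ev_neq0.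
  rewrite {1}ey s_frac // !rmorphXn /= ev2X /z' exprMn.
  by rewrite z_eqW mulrA mulfK // ev_neq0.
Qed.

Lemma rmorph_ev2 (s : {rmorphism L -> L}) f g T :
  (forall c, s (iota c) = iota c) -> s (ev2 iota f g T) = ev2 iota (s f) (s g) T.
Proof.
move=> sc; have sev p : s (ev iota f p) = ev iota (s f) p.
  rewrite !evE rmorph_sum; apply: eq_bigr => i _.
  by rewrite /= rmorphM rmorphXn /= sc.
rewrite !(ev2E _ _ _ (leqnn _)) rmorph_sum; apply: eq_bigr => i _.
by rewrite /= rmorphM rmorphXn /= sev.
Qed.

Lemma twist_place (R : place iota) (a : K) : a ^+ N = 1 ->
  exists (s : {rmorphism L -> L}) (R' : place iota),
    [/\ forall c, s (iota c) = iota c, s v = v, s z = iota a * z,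
        s y = iota (a ^+ m) * y & forall f, R' f = R (s f)].
Proof.
move=> aN; have [s [sc sv sz sy]] := twist_exists aN; exists s.
have a0 : a != 0.
  apply: contraTneq isT => a0; move: aN.
  by rewrite a0 expr0n gtn_eqF // => /eqP; rewrite eq_sym oner_eq0.
have s0 f : f != 0 -> s f != 0 by rewrite fmorph_eq0.
have r0 : R (s 0) = 0 by rewrite rmorph0 val0.
have rM f g : f != 0 -> g != 0 -> R (s (f * g)) = R (s f) + R (s g).
  by move=> f0 g0; rewrite rmorphM valM ?s0.
have rD f g : f != 0 -> g != 0 -> f + g != 0 ->
    Num.min (R (s f)) (R (s g)) <= R (s (f + g)).
  by move=> f0 g0 fg0; rewrite rmorphD valD ?s0 // -rmorphD s0.
have rc c : c != 0 -> R (s (iota c)) = 0 by move=> _; rewrite sc val_cst.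
(* The twist is onto: replacing [z] by [a^-1 z] in a fraction gives a preimage, so a uniformizer
   pulls back. *)
have ru : exists2 f, f != 0 & R (s f) = 1.
  have [f f0 Rf] := val_unif R; have [d [T [d0 _ ef]]] := function_field_fraction f.
  have e : s (ev2 iota v (iota a^-1 * z) T / evv d) = f.
    have sd : s (evv d) = evv d by rewrite -(ev2C iota v v) rmorph_ev2 // sv.
    rewrite rmorphM (fmorphV s) /= sd rmorph_ev2 // rmorphM /= sv sc sz.
    by rewrite mulrA -rmorphM mulVf // rmorph1 mul1r -ef.
  exists (ev2 iota v (iota a^-1 * z) T / evv d); last by rewrite e.
  by apply: contraNneq f0 => h; rewrite -e h rmorph0.
by exists (Place r0 rM rD rc ru).
Qed.

(** * Components isolated by averaging over the twists *)

Let natm1 (F : comNzRingType) (h : {rmorphism K -> F}) : m%:R = 1 :> F.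
Proof.
have q0 := natq0 q_char h q_gt1.
rewrite mM (_ : q ^ 2 - q = q * (q - 1))%N; last by rewrite mulnBr muln1 mulnn.
by rewrite natrD !natrM q0 mul0r mulr0 add0r.
Qed.

Let natN1 : N%:R = 1 :> K.
Proof.
by rewrite natrM natrD (natm1 idfun) (natq0 q_char idfun q_gt1) add0r mul1r.
Qed.

Let wN k : (w ^+ k) ^+ N = 1.
Proof. by rewrite -exprM mulnC exprM (prim_expr_order w_prim) expr1n. Qed.

Let twist_zy_term (s : {rmorphism L -> L}) a c d jr :
  (forall c, s (iota c) = iota c) -> s v = v -> s z = iota a * z ->
  s y = iota (a ^+ m) * y ->
  s (zy_term c jr / evv d) = iota (a ^+ (jr.1 + m * jr.2)) * (zy_term c jr / evv d).
Proof.
move=> sc sv sz sy.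
have sev p : s (evv p) = evv p by rewrite -(ev2C iota v v) rmorph_ev2 // sv.
rewrite !rmorphM /= !rmorphXn /= (fmorphV s) /= !sev sz sy !exprMn exprD exprM.
by rewrite rmorphXn /zy_term /=; ring.
Qed.

Let val_ge_twist (R R' : place iota) (s : {rmorphism L -> L}) f a :
  (forall f, R' f = R (s f)) -> val_ge R' a f -> val_ge R a (s f).
Proof. by move=> h [->|hf]; [left; rewrite rmorph0|right; rewrite -h]. Qed.

Lemma val_ge_component (R : place iota) c d jr :
  (forall (s : {rmorphism L -> L}) (R' : place iota) a,
    [/\ forall c, s (iota c) = iota c, s v = v, s z = iota a * z,
        s y = iota (a ^+ m) * y & forall f, R' f = R (s f)] ->
    val_ge R' 0 (zy_sum c / evv d)) ->
  val_ge R 0 (zy_term c jr / evv d).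
Proof.
move=> h; pose e (jr : 'I_m * 'I_(q + 1)) := (jr.1 + m * jr.2)%N.
have eN jr' : (e jr' < N)%N.
  by case: jr' => [j r]; apply: mixed_radix_lt.
have := @val_ge_average _ _ iota R _ (fun jr => zy_term c jr / evv d) e N w 0
  (e jr) w_prim natN1.
rewrite (eq_bigl (pred1 jr)) ?big_pred1_eq; last first.
  move=> jr'; rewrite /= !modn_small //; apply/eqP/eqP => [|-> //].
  case: jr jr' => [j r] [j' r'] /= => e1.
  have e0 : (j' + m * r' + N * 0 = j + m * r + N * 0)%N by congr (_ + _)%N; exact: e1.
  have [e2 e3] := mixed_radix_inj (ltn_ord _) (ltn_ord _) (ltn_ord _) (ltn_ord _) e0.
  by rewrite (val_inj e2) (val_inj e3).
apply => k; have [s [R' [sc sv sz sy sR]]] := twist_place R (wN k).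
have := val_ge_twist sR (h s R' (w ^+ k) (And5 sc sv sz sy sR)).
congr (val_ge R 0 _); rewrite zy_sumE mulr_suml rmorph_sum; apply: eq_bigr => i _.
by rewrite /= (twist_zy_term _ _ _ sc sv sz sy) exprM.
Qed.

(** The derivative of [pS] is [-1] in this characteristic, so no irreducible factor is repeated. *)
Let pS_coprime (pi p : {poly K}) : irreducible_poly pi -> pS = pi * p -> coprimep p pi.
Proof.
move=> pi_irr e; apply: irredp_coprimep => //; apply/negP => /dvdpP[p' ep].
have : pi %| pS^`().
  rewrite e derivM ep derivM mulrDr.
  apply: dvdp_add; first by do 2 apply: dvdp_mull.
  by apply: dvdp_add; apply: dvdp_mulr.
have -> : pS^`() = - 1.
  rewrite /pS derivB derivXn derivX -mulr_natl natrX.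
  rewrite (natq0 q_char (polyC : {rmorphism K -> {poly K}}) q_gt1).
  by rewrite expr0n mul0r sub0r.
rewrite dvdpNr dvdp1 => /eqP h; have [h1 _] := pi_irr.
by rewrite h in h1.
Qed.

Let val_pS_le (R : place iota) pi : irreducible_poly pi -> 0 < R (evv pi) -> 0 <= R v ->
  R (evv pS) <= R (evv pi).
Proof.
move=> pi_irr Rpi Rv; have [/dvdpP[p e]|nd] := boolP (pi %| pS); last first.
  by rewrite (val_ev_coprime Rpi Rv (irredp_coprimep pi_irr nd)) ltW.
rewrite mulrC in e; have cop := pS_coprime pi_irr e.
have p0 : p != 0 by apply: contraNneq pS_neq0 => p0; rewrite e p0 mulr0.
have pi0 : pi != 0 := irredp_neq0 pi_irr.
by rewrite e rmorphM valM ?ev_neq0 //= (val_ev_coprime Rpi Rv cop) addr0.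
Qed.

(* Above an irreducible [pi] dividing the denominator of a component, the value
   of [z ^ j * y ^ r] is smaller than that of [pi], because [pS] is squarefree:
   it cannot compensate the pole. *)
Lemma component_dvdp f c (d : {poly K}) k : two_point_ring Q P f ->
  f = zy_sum c / evv (d * 'X^k) -> ~~ root d 0 -> forall jr, d %| c jr.1 jr.2.
Proof.
move=> hf ef rd jr.
have d0 : d != 0 by apply: contraNneq rd => ->; rewrite root0.
have [->|c0] := eqVneq (c jr.1 jr.2) 0; first exact: dvdp0.
pose cj := c jr.1 jr.2; pose g := gcdp cj d.
have g0 : g != 0 by rewrite gcdp_eq0 negb_and d0 orbT.
have ec : cj = (cj %/ g) * g by rewrite divpK ?dvdp_gcdl.
have ed : d = (d %/ g) * g by rewrite divpK ?dvdp_gcdr.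
set c1 := cj %/ g in ec; set d1 := d %/ g in ed.
have cop : coprimep c1 d1 by apply: coprimep_div_gcd; rewrite d0 orbT.
have c10 : c1 != 0 by apply: contraNneq c0; rewrite -/cj ec => ->; rewrite mul0r.
have d10 : d1 != 0 by apply: contraNneq d0; rewrite ed => ->; rewrite mul0r.
have [s1|s1] := leqP (size d1) 1.
  have d1u : d1 %= 1.
    by rewrite -size_poly_eq1 eqn_leq s1 size_poly_gt0.
  by rewrite -/cj ec [X in X %| _]ed dvdp_mul2r // (eqp_dvdl _ d1u) dvd1p.
exfalso; have [pi pi_irr pid] := irredp_factor s1.
have pi_d : pi %| d by rewrite ed dvdp_mulr.
have copX : coprimep 'X pi.
  apply: irredp_coprimep => //; apply: contra rd => piX.
  have [s2 irr] := pi_irr.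
  have : pi %= 'X.
    rewrite -(dvdp_size_eqp piX) size_polyX eqn_leq s2 andbT.
    by rewrite -(size_polyX K) dvdp_leq // polyX_eq0.
  move/eqp_dvdl => h; move: pi_d; rewrite h -['X]subr0 -polyC0 dvdp_XsubCl.
  done.
have [R [Rpi Rv]] := place_over pi_irr.
(* [pi] is prime to [X], so [v] has value [0] at [R] and at its conjugates: none of them is [Q] or
   [P]. *)
have Rv0 : R v = 0 by have := val_ev_coprime Rpi Rv copX; rewrite evX.
have : val_ge R 0 (zy_term c jr / evv (d * 'X^k)).
  apply: val_ge_component => s R' a [sc sv sz sy sR]; rewrite -ef.
  have Rv' : R' v = 0 by rewrite sR sv.
  apply: hf => e; first by move: Qv; rewrite -e Rv' ltxx.
  by move: Pv; rewrite -e Rv' ltxx.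
have zyc0 : zy_term c jr != 0 by rewrite zy_term_neq0.
have dX0 : d * 'X^k != 0 by rewrite mulf_neq0 // expf_neq0 // polyX_eq0.
move/(val_geE (mulf_neq0 zyc0 (invr_neq0 (ev_neq0 dX0)))).
rewrite valM ?invr_neq0 ?ev_neq0 // valV rmorphM valM ?ev_neq0 ?expf_neq0 ?polyX_eq0 //=.
rewrite evXn valX Rv0 mul0r addr0 !valM ?mulf_neq0 ?expf_neq0 ?ev_neq0 // !valX.
rewrite -/cj ec [in X in _ - X]ed !rmorphM !valM ?ev_neq0 //=.
have copc1 : coprimep c1 pi by apply: coprimep_dvdl pid cop.
rewrite (val_ev_coprime Rpi Rv copc1).
have : R (evv pi) <= R (evv d1).
  have [d2 e2] := dvdpP _ _ pid; rewrite e2 rmorphM valM ?ev_neq0 //=.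
  - rewrite lerDr; apply: val_geE.
      by apply: ev_neq0; apply: contraNneq d10; rewrite e2 => ->; rewrite mul0r.
    by apply: val_ge_ev; right.
  - by apply: contraNneq d10; rewrite e2 => ->; rewrite mul0r.
  - exact: irredp_neq0 pi_irr.
have hA : 0 <= R (evv pA) by apply: val_geE (ev_neq0 pA_neq0) _; apply: val_ge_ev; right.
have hW : 0 <= R (evv pW) by apply: val_geE (ev_neq0 pW_neq0) _; apply: val_ge_ev; right.
have hS : R (evv pA) + R (evv pW) <= R (evv pi).
  by rewrite -valM ?ev_neq0 // -rmorphM pA_mul_pW; apply: val_pS_le.
have Ry : R y * (q + 1)%N%:Z = R (evv pA) by rewrite -valX y_eqA.
have Rz : R z * m%:Z = R y + R (evv pW) by rewrite -valX z_eqW valM ?ev_neq0.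
move=> hX.
have := ramified_weight_lt (ltn_ord jr.1) (ltn_ord jr.2) Rpi hX hA hW hS Ry Rz.
by rewrite add0r opprD addrACA subrr addr0 subr_ge0 => /lt_geF ->.
Qed.

(** On the Hermitian curve the twist multiplies [y] by [w ^ (k m)], a power of a primitive
    [(q+1)]-st root of unity. The indices [1] to [q] thus move [P] to the other points at
    infinity. *)
Definition conj_place k (R : place iota) := exists s : {rmorphism L -> L},
  [/\ forall c, s (iota c) = iota c, s v = v, s z = iota (w ^+ k) * z,
      s y = iota ((w ^+ k) ^+ m) * y & forall f, R f = P (s f)].

Let zeta k := (w ^+ k) ^+ m.

Let zeta_inj k k' : (k < q + 1)%N -> (k' < q + 1)%N -> zeta k = zeta k' -> k = k'.
Proof.
move=> hk hk' /eqP; rewrite /zeta -!exprM (eq_prim_root_expr w_prim).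
by rewrite ![(_ * m)%N]mulnC -!muln_modr eqn_pmul2l // !modn_small // => /eqP.
Qed.

Let zeta_neq1 k : (0 < k < q + 1)%N -> zeta k != 1.
Proof.
move=> /andP[k0 kq]; apply/eqP => e; have := @zeta_inj k 0 kq.
by rewrite addn1 => /(_ isT); rewrite e /zeta expr0 expr1n => /(_ erefl) h; rewrite h in k0.
Qed.

(** The twist of [t] is [(zeta k - 1) y + t]. At [P], where [t] vanishes, it has the pole of [y], of
    order [m]; and [y] is there [-v] up to a regular term, whence the residue of [b = v / t]. *)
Lemma val_conj_place k (R : place iota) : (0 < k < q + 1)%N -> conj_place k R ->
  [/\ R v = - m%:Z, R t = - m%:Z, R z = - (q ^ 2 - q)%N%:Z,
      has_residue R u (-1) & has_residue R b (1 - zeta k)^-1].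
Proof.
move=> hk [s [sc sv sz sy sR]]; have z1 := zeta_neq1 hk.
have [Pv' Pt' _ _ Pz'] := val_at_tangent_eq Pv Pt.
have [Py' _] := val_at_infinity Pv; rewrite Pv' in Py'.
have c0 : iota (zeta k - 1) != 0 by rewrite fmorph_eq0 subr_eq0.
have st : s t = iota (zeta k - 1) * y + t.
  by rewrite rmorphB rmorph1 !(rmorphD s) (rmorph1 s) /= sv sy -/(zeta k); ring.
have [st0 Pst] : s t != 0 /\ P (s t) = - m%:Z.
  rewrite st; have := @val_addl_lt _ _ _ P (iota (zeta k - 1) * y) t (mulf_neq0 c0 y_neq0).
  rewrite valM // val_cst add0r Py' Pt'; apply.
  by move: m_gt0; clear; lia.
have w0 : w ^+ k != 0.
  apply: contraTneq isT => w0; have := wN k.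
  by rewrite w0 expr0n gtn_eqF // => /eqP; rewrite eq_sym oner_eq0.
split.
- by rewrite sR sv.
- by rewrite sR.
- by rewrite sR sz valM ?fmorph_eq0 // val_cst add0r.
- apply/vanishesE; rewrite rmorphN1 opprK uD1; right.
  by rewrite sR fmorphV valV Pst opprK; move: m_gt0; clear; lia.
- apply/vanishesE.
  have z1' : 1 - iota (zeta k) != 0 by rewrite -(rmorph1 iota) -rmorphB fmorph_eq0 subr_eq0 eq_sym.
  have es : s (b - iota (1 - zeta k)^-1) =
      (- iota (zeta k) * t - (1 - iota (zeta k))) * ((1 - iota (zeta k))^-1 * (s t)^-1).
    rewrite (rmorphB s) sc (rmorphM s) (fmorphV s) /= sv fmorphV rmorphB rmorph1.
    have -> : - iota (zeta k) * t - (1 - iota (zeta k)) = v * (1 - iota (zeta k)) - s t.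
      by rewrite st rmorphB rmorph1; ring.
    by move: (s t) st0 => X X0; field; rewrite X0 z1'.
  suff [e0|h] : val_ge P 1 (s (b - iota (1 - zeta k)^-1)).
    by left; apply/eqP; rewrite -(fmorph_eq0 s) e0.
    by right; rewrite sR.
  rewrite es -[X in val_ge _ X _]add0r; apply: val_geM.
    apply: val_geB; last by rewrite -(rmorph1 iota) -rmorphB; apply: val_ge_cst.
    rewrite -[X in val_ge _ X _]add0r; apply: val_geM.
      by apply: val_geN; apply: val_ge_cst.
    by right; rewrite Pt'.
  right; rewrite valM ?invr_neq0 // !valV Pst -(rmorph1 iota) -rmorphB val_cst.
  by rewrite oppr0 add0r opprK; move: m_gt0; clear; lia.
Qed.

Let conj_place_exists k : exists R : place iota, conj_place k R.
Proof.
have [s [R [sc sv sz sy sR]]] := twist_place P (wN k).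
by exists R, s; split.
Qed.

(* [u + 1] generates the ideal of the [q] points conjugate to [P] in [K[b, u]]. *)
Lemma bu_div_uD1 f : bu_poly f ->
    (forall k (R : place iota), (0 < k < q + 1)%N -> conj_place k R -> val_ge R 1 f) ->
  exists2 f', bu_poly f' & f = (u + 1) * f'.
Proof.
move=> [T0 ef0] hf; have [T1 eT1] := ev2_swap iota b u T0.
(* The curve equation read as monic of degree [q] in [b] over [K[u]], so that [u + 1] can be divided
   out coefficientwise. *)
pose H : {poly {poly K}} := 'X^q + 'X - ('X^(q + 1))%:P.
have sX : (size ('X - ('X^(q + 1))%:P : {poly {poly K}})%R <
    size ('X^q : {poly {poly K}})%R)%N.
  by rewrite size_XsubC size_polyXn.
have Hm : H \is monic.
  by rewrite /H -addrA monicE lead_coefDl // lead_coefXn.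
have sH : size H = q.+1 by rewrite /H -addrA size_polyDl // size_polyXn.
have H0 : ev2 iota u b H = 0.
  rewrite ev2B rmorphD rmorphXn /= ev2X ev2C evXn hermitian_normal_form.
  by rewrite subrr.
have [T sT eT] := ev2_reduce T1 Hm H0; rewrite sH ltnS in sT.
have {ef0 eT1} ef : f = ev2 iota u b T by rewrite ef0 eT1 eT.
(* The restriction of [f] to [u = -1]: a polynomial in [b] of degree below [q] with [q] distinct
   roots, the residues of [b] at the conjugates. It is zero, so [u + 1] divides every
   coefficient. *)
pose T' : {poly K} := \poly_(i < q) (T`_i).[-1].
have T'0 : T' = 0.
  apply: (@roots_geq_poly_eq0 _ _ [seq (1 - zeta k)^-1 | k <- seq.iota 1 q]).
  - apply/allP => _ /mapP[k hk0 ->].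
    have hk : (0 < k < q + 1)%N by rewrite addn1; move: hk0; rewrite mem_iota add1n.
    have [R hR] := conj_place_exists k.
    have [_ _ _ Ru Rb] := val_conj_place hk hR.
    have := residue_ev2 T Ru Rb; rewrite -ef => hres.
    have /residue0P := hf k R hk hR => hres0.
    rewrite rootE -(residue_inj hres hres0) horner_poly (horner_coef_wide _ sT).
    rewrite horner_sum; apply/eqP/eq_bigr => i _.
    by rewrite hornerM -polyC_exp hornerC.
  - rewrite map_inj_in_uniq ?iota_uniq // => k k'.
    rewrite !mem_iota !add1n => /andP[_ hk] /andP[_ hk'] /invr_inj.
    by move/(congr1 (fun c => 1 - c)); rewrite !subKr; apply: zeta_inj; rewrite addn1.
  - by rewrite size_map size_iota size_poly.
have hroot i : exists p, T`_i = p * ('X + 1).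
  have [iq|iq] := ltnP i q; last first.
    by exists 0; rewrite mul0r nth_default // (leq_trans sT).
  have /factor_theorem[p ->] : root T`_i (-1).
    by have := congr1 (fun p : {poly K} => p`_i) T'0; rewrite coef_poly iq coef0 rootE => ->.
  by exists p; rewrite polyCN opprK.
have /boolp.choice[p hp] := hroot.
exists (\sum_(i < q) ev iota u (p i) * b ^+ i).
  elim/big_ind: _ => [|f1 f2|i _]; first by rewrite -(rmorph0 iota).
    exact: bu_D.
  apply: bu_M; last exact: bu_X.
  have [T2 e2] := ev2_swap iota u b (p i)%:P.
  by exists T2; rewrite -e2 ev2C.
rewrite ef (ev2E _ _ _ sT) mulr_sumr; apply: eq_bigr => i _.
by rewrite hp rmorphM rmorphD rmorph1 /= evX; ring.
Qed.

Lemma bu_div_uD1_pow B f : bu_poly f ->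
    (forall k (R : place iota), (0 < k < q + 1)%N -> conj_place k R ->
      val_ge R (B * m)%N%:Z f) ->
  exists2 f', bu_poly f' & f = (u + 1) ^+ B * f'.
Proof.
elim: B f => [|B IH] f hf hR; first by exists f; rewrite // expr0 mul1r.
have [|f1 hf1 ef] := bu_div_uD1 hf.
  move=> k R hk ck; apply: val_ge_le (hR k R hk ck).
  by move: m_gt0; clear; nia.
have [|f2 hf2 ef1] := IH f1 hf1; last first.
  by exists f2 => //; rewrite ef ef1 exprS mulrA.
move=> k R hk ck; have := hR k R hk ck; rewrite ef.
have [-> _|f10] := eqVneq f1 0; first by left.
move/(val_geE (mulf_neq0 uD1_neq0 f10)); rewrite valM // uD1 valV.
have [_ -> _ _ _] := val_conj_place hk ck; rewrite opprK => h; right.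
by move: h; rewrite mulSn PoszD lerD2l.
Qed.

Let part c (j : 'I_m) := \sum_(r < q + 1) y ^+ r * evv (c j r).

(** Twists by [m]-th roots of unity fix [v] and [y], hence [t], so the condition [R t <= R v] that
    separates [R] from [P] survives. Averaging over all [N]-th roots could move [R] onto [P], where
    [f] may have a pole. *)
Lemma val_ge_part (R : place iota) f c k (j : 'I_m) : two_point_ring Q P f ->
  f = zy_sum c / v ^+ k -> R v < 0 -> R t <= R v ->
  val_ge R 0 (z ^+ j * part c j / v ^+ k).
Proof.
move=> hf ef Rv Rt; pose w' := w ^+ (q + 1).
have w'_prim : m.-primitive_root w'.
  have := dvdn_prim_root w_prim (dvdn_mulr (q + 1) (dvdnn m)).
  by rewrite mulKn.
have := @val_ge_average _ _ iota R _ (fun jr => zy_term c jr / evv 'X^k)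
   (fun jr : 'I_m * 'I_(q + 1) => jr.1 : nat) m w' 0 j w'_prim (natm1 idfun).
have -> : \sum_(jr : 'I_m * 'I_(q + 1) | jr.1 == j %[mod m]) zy_term c jr / evv 'X^k =
    z ^+ j * part c j / v ^+ k.
  rewrite (eq_bigl (fun jr => (jr.1 == j) && true)); last first.
    by move=> [i r] /=; rewrite !modn_small // andbT.
  rewrite -(pair_big (fun i => i == j) xpredT (fun i r => zy_term c (i, r) / evv 'X^k)).
  rewrite big_pred1_eq evXn /part mulr_sumr mulr_suml; apply: eq_bigr => r _.
  by rewrite /zy_term /=; ring.
apply => i; have w'N : ((w ^+ ((q + 1) * i)) ^+ N = 1) by exact: wN.
have w'm : (w ^+ ((q + 1) * i)) ^+ m = 1.
  by rewrite -exprM mulnAC [((q + 1) * m)%N]mulnC exprM (prim_expr_order w_prim) expr1n.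
have [s [R' [sc sv sz sy sR]]] := twist_place R w'N.
have sy1 : s y = y by rewrite sy w'm rmorph1 mul1r.
have : val_ge R' 0 f.
  apply: hf => e.
    by move: Qv; rewrite -e sR sv => h; have := lt_trans h Rv; rewrite ltxx.
  move: Pt; rewrite -!e !sR !rmorphD rmorph1 /= sv sy1.
  by rewrite ltNge Rt.
move/(val_ge_twist sR); congr (val_ge R 0 _).
rewrite ef zy_sumE -(evXn iota) mulr_suml rmorph_sum; apply: eq_bigr => jr _.
rewrite /= (twist_zy_term _ _ _ sc sv sz sy) exprD [_ ^+ (m * _)]exprM w'm expr1n mulr1.
by rewrite /w' -!exprM mulnA.
Qed.

(** * Upper and lower bounds for tau *)

Let Qvals : [/\ Q v = N%:Z, Q y = m%:Z & Q z = 1].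
Proof. by have [d _ [<- -> ->]] := val_over_zero Qv; rewrite val_z_over_zero // !mulr1. Qed.

Let Qtbu : [/\ Q t = 0, Q b = (q.+1 * m)%N%:Z & Q u = m%:Z].
Proof.
have [Qv' Qy Qz] := Qvals.
have ny0 : - y != 0 by rewrite oppr_eq0.
have [vy0 Qvy] : - y - v != 0 /\ Q (- y - v) = m%:Z.
  have := @val_addl_lt _ _ _ Q (- y) (- v) ny0.
  rewrite !valN Qv' Qy; apply.
  by move: q_gt1 m_gt0; clear; nia.
have Qt : Q t = 0.
  have -> : t = 1 + - (- y - v) by ring.
  have [|_ ->] := @val_addl _ _ _ Q 1 (- (- y - v)) (oner_neq0 _); last by rewrite val_one.
  by right; rewrite val_one valN Qvy; move: m_gt0; clear; lia.
split => //.
  by rewrite valM ?invr_neq0 // valV Qt subr0 Qv' mulnC addn1.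
have -> : u = (- y - v) / t by field.
by rewrite valM ?invr_neq0 // valV Qt subr0 Qvy.
Qed.

Let bu_indepQ : independent_below q.+1 (Q b) (Q u).
Proof.
have [_ -> ->] := Qtbu; rewrite PoszM; apply: independent_below_mul.
by move: m_gt0; clear; lia.
Qed.

Lemma tau_upper_bound (k : int) (l be ga : nat) :
    (be * (q ^ 2 - q) <= ga * m)%N ->
  weierstrass_semigroup Q P (- (k * N%:Z + l%:Z * m%:Z + be%:Z))
    (k * N%:Z + (ga + l)%N%:Z * m%:Z * q%:Z + be%:Z * (q ^ 2 - q)%N%:Z).
Proof.
move=> hga; exists (u ^+ l * b ^ k * (u + 1) ^+ ga * z ^+ be).
have f0 : u ^+ l * b ^ k * (u + 1) ^+ ga * z ^+ be != 0.
  by rewrite !mulf_neq0 ?expf_neq0 ?expfz_neq0.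
have valf (R : place iota) : R (u ^+ l * b ^ k * (u + 1) ^+ ga * z ^+ be) =
    R u * l%:Z + R b * k - R t * ga%:Z + R z * be%:Z.
  rewrite ![in LHS]valM ?mulf_neq0 ?expf_neq0 ?expfz_neq0 //.
  by rewrite !valX valXz uD1 valV mulNr.
split => //; last 2 first.
- rewrite valf; have [_ _ ->] := Qvals; have [-> -> ->] := Qtbu.
  by rewrite opprK !PoszM -addn1 !PoszD; ring.
- rewrite valf; have [_ -> -> -> ->] := val_at_tangent_eq Pv Pt.
  by rewrite !PoszM -addn1 !PoszD; ring.
move=> R nQ nP; right; rewrite valf.
have Rv0 : R v <= 0.
  by rewrite leNgt; apply/negP => Rv; apply: nQ; apply: place_over_zero_unique.
move: Rv0; rewrite le_eqVlt => /orP[/eqP Rv|Rv].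
  have reg p : 0 <= R (evv p).
    have [->|p0] := eqVneq p 0; first by rewrite rmorph0 val0.
    by apply: (val_geE (ev_neq0 p0)); apply: val_ge_ev; right; rewrite Rv.
  have Ry : 0 <= R y.
    rewrite -(pmulr_lge0 _ (_ : 0 < (q + 1)%N%:Z)) ?addn1 // -addn1 -valX y_eqA.
    exact: reg.
  have Rz : 0 <= R z.
    rewrite -(pmulr_lge0 _ (_ : 0 < m%:Z)) // -valX z_eqW valM ?ev_neq0 //.
    by rewrite addr_ge0.
  have Rt0 : 0 <= R t.
    apply: (val_geE t_neq0); apply: val_geD; last by right.
    by apply: val_geD; right; rewrite ?Rv ?val_one.
  have Rb : R b = - R t by rewrite valM ?invr_neq0 // valV Rv add0r.
  (* A zero of [t] here would give [b] and [u] poles of the same order, against the normal form. *)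
  have Rt : R t = 0.
    apply/eqP; rewrite eq_le Rt0 andbT leNgt; apply/negP => Rt.
    have Ru1 : R (u + 1) = - R t by rewrite uD1 valV.
    have Ru : R u = - R t.
      have -> : u = (u + 1) + -1 by rewrite addrK.
      have [|_ ->] := @val_addl _ _ _ R (u + 1) (-1) uD1_neq0; last by [].
      by right; rewrite Ru1 valN val_one; move: Rt; clear; lia.
    have : R (u ^+ (q + 1)) = R b * q%:Z.
      rewrite hermitian_normal_form -valX.
      have [|_ -> //] := @val_addl_lt _ _ _ R (b ^+ q) b (expf_neq0 _ b_neq0).
      by rewrite valX Rb; move: Rt q_gt1; clear; nia.
    by rewrite valX Ru Rb; move: Rt q_gt1; clear; nia.
  have Ru : 0 <= R u.
    apply: (val_geE u_neq0); apply: val_geB; right; last by rewrite val_one.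
    by rewrite valV Rt.
  by rewrite Rb Rt oppr0 !mul0r addr0 subr0 addr_ge0 // mulr_ge0.
have Rtv : R t = R v.
  apply/eqP; rewrite eq_le; apply/andP; split.
    by rewrite leNgt; apply/negP => Rt; apply: nP; apply: place_at_tangent_unique.
  have [Ry _] := val_at_infinity Rv.
  apply: (val_geE t_neq0); apply: val_geD; last by right; rewrite Ry.
  by apply: val_geD; right; rewrite // val_one ltW.
have [_ Rz] := val_at_infinity Rv.
have Ru : 0 <= R u.
  apply: (val_geE u_neq0); apply: val_geB; right; last by rewrite val_one.
  by rewrite valV Rtv oppr_ge0 ltW.
have Rb : R b = 0 by rewrite valM ?invr_neq0 // valV Rtv subrr.
(* What remains is the zero of [(u + 1) ^ ga] against the pole of [z ^ be]; the hypothesis on [ga]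
   says that the zero prevails. *)
rewrite Rb mul0r addr0 -addrA addr_ge0 ?mulr_ge0 // Rtv.
rewrite -(pmulr_lge0 _ (_ : 0 < m%:Z)) //.
have -> : (- (R v * ga%:Z) + R z * be%:Z) * m%:Z =
    (- R v) * ((ga * m)%N%:Z - (be * (q ^ 2 - q))%N%:Z).
  rewrite mulrDl [R z * _ * _]mulrAC Rz !PoszM; ring.
by apply: mulr_ge0; [rewrite oppr_ge0 ltW|rewrite subr_ge0 lez_nat].
Qed.

Let val_part_mul (R : place iota) c j : R v < 0 -> R v < R t -> part c j != 0 ->
  exists a : int, R (part c j) = m%:Z * a.
Proof.
move=> Rv Rt p0; have [A [S [_ hS]]] := zbu_fraction c 0; have [sS eS] := hS j.
have S0 : ev2 iota b u (S j) != 0 by rewrite -eS mulf_neq0 ?expf_neq0.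
have Sn0 : S j != 0 by apply: contraNneq S0 => ->; rewrite rmorph0.
have [_ [k]] := val_bu Rv Rt Sn0 sS.
have [Rv' Rt' _ _ _] := val_at_tangent_eq Rv Rt.
rewrite -eS -/(part c j) valM ?expf_neq0 // valX uD1 valV Rv' Rt' => e.
by exists (q%:Z * A%:Z - k%:Z); move: e; rewrite PoszM; clear; lia.
Qed.

Lemma tau_lower_bound (k : int) (l be ga : nat) f :
    (l < q + 1)%N -> (be < m)%N ->
    (forall a : int, (be * (q ^ 2 - q))%N%:Z <= m%:Z * a -> ga%:Z <= a) ->
    two_point_ring Q P f -> f != 0 -> Q f = k * N%:Z + l%:Z * m%:Z + be%:Z ->
  P f <= - (k * N%:Z + (ga + l)%N%:Z * m%:Z * q%:Z + be%:Z * (q ^ 2 - q)%N%:Z).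
Proof.
move=> hl hbe hga hf f0 Qf.
have [s [c ef]] : exists (s : nat) c, f = zy_sum c / v ^+ s.
  have [d [c [d0 ef]]] := zy_fraction f.
  (* [s] is the multiplicity of the root [0] of [d]; the cofactor [d'] divides all components and
     cancels. *)
  have [s [d' rd' ed]] := multiplicity_XsubC d 0; rewrite d0 subr0 /= in rd' ed.
  have d'0 : d' != 0 by apply: contraNneq rd' => ->; rewrite root0.
  rewrite ed in ef; have dv := component_dvdp hf ef rd'.
  exists s, (fun j r => c j r %/ d').
  rewrite ef rmorphM rmorphXn /= evX.
  have -> : zy_sum c = evv d' * zy_sum (fun j r => c j r %/ d').
    rewrite /zy_sum mulr_sumr; apply: eq_bigr => j _; rewrite mulr_sumr; apply: eq_bigr => r _.
    by rewrite -{1}(divpK (dv (j, r))) rmorphM /=; ring.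
  by field; rewrite expf_neq0 // ev_neq0.
have zy0 : zy_sum c != 0 by apply: contraNneq f0; rewrite ef => ->; rewrite mul0r.
have [Qv' Qy Qz] := Qvals; have [Qt Qb Qu] := Qtbu.
have [Pv' Pt' Pb Pu Pz] := val_at_tangent_eq Pv Pt.
have [[j r] [k0 [cjr0 /= Qs Qs' Qmin]]] := val_zy_sum Qv zy0.
(* The value at [Q] of the numerator is [(s + k) N + l m + be], whose mixed-radix digits identify
   the dominant term. *)
have [ej er ek] : [/\ j = be :> nat, r = l :> nat & k0%:Z = s%:Z + k].
  apply: (@mixed_radix_int_inj m (q + 1)) => //.
  have : Q f = Q (zy_sum c) - Q v * s%:Z.
    by rewrite ef valM ?invr_neq0 ?expf_neq0 // valV valX.
  by rewrite Qs' Qz mul1r Qf Qv'; move=> h; rewrite mulrDr; move: h; clear; lia.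
pose H0 := part c j.
(* The coefficients cut down to row [j]. The dominant term is kept, so the [z ^ be] part has the
   same value at [Q] as the whole sum. *)
pose c' (i : 'I_m) (r' : 'I_(q + 1)) := if i == j then c i r' else 0.
have ec' : zy_sum c' = z ^+ j * H0.
  rewrite /zy_sum (bigD1 j) //= [X in _ + X]big1 ?addr0.
    rewrite /H0 /part [RHS]mulr_sumr; apply: eq_bigr => r' _.
    by rewrite /c' eqxx mulrA.
  move=> i ij; apply: big1 => r' _.
  by rewrite /c' (negbTE ij) rmorph0 mulr0.
have zyc'0 : zy_sum c' != 0.
  by apply: (@zy_sum_neq0 c' (j, r)); rewrite /c' /= eqxx.
have QH : Q (z ^+ j * H0) = Q (zy_sum c).
  rewrite -ec'; have [[i1 r1] [_ [/= c1 e1 _ min1]]] := val_zy_sum Qv zyc'0.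
  have ij : i1 = j by apply: contraNeq c1 => /negbTE h; rewrite /c' h.
  subst i1; have c'E r' : c' j r' = c j r' by rewrite /c' eqxx.
  apply/eqP; rewrite eq_le; apply/andP; split.
    by have := min1 (j, r); rewrite /zy_term /= !c'E Qs; apply.
  rewrite e1 /zy_term /= c'E; apply: (Qmin (j, r1)).
  by rewrite /= -c'E.
have H00 : H0 != 0 by move: zyc'0; rewrite ec' mulf_eq0 negb_or => /andP[].
have [A [S [hA hS]]] := zbu_fraction c s.
have eS := zy_sum_zbu (fun j => (hS j).2).
have [sSj eSj] := hS j; rewrite -/(part c j) -/H0 in eSj.
have H1bu : bu_poly (H0 * (u + 1) ^+ A) by rewrite eSj; exists (S j).
(* At the conjugates, [(u + 1) ^ A] has value [A m], and regularity of [z ^ be * H0 / v ^ s] gives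
   [H0] a value of at least [(ga - s) m] after rounding to a multiple of [m]. *)
pose B := (A - s + ga)%N.
have H10 : H0 * (u + 1) ^+ A != 0 by rewrite mulf_neq0 ?expf_neq0.
have [|H2 [T0 eT0] eH2] := bu_div_uD1_pow (B := B) H1bu.
  move=> i R hi hR; have [Rv Rt Rz _ _] := val_conj_place hi hR.
  have [s' [sc sv sz sy sR]] := hR.
  have Rv0 : R v < 0 by rewrite Rv; move: m_gt0; clear; lia.
  have Rtv : R t <= R v by rewrite Rv Rt.
  have zH0 : z ^+ j * H0 != 0 by rewrite mulf_neq0 ?expf_neq0.
  have := val_ge_part j hf ef Rv0 Rtv; rewrite -/(part c j) -/H0.
  move/(val_geE (mulf_neq0 zH0 (invr_neq0 (expf_neq0 s v_neq0)))).
  rewrite valM ?invr_neq0 ?expf_neq0 // valM ?expf_neq0 // valV !valX Rv Rz => hge.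
  (* The value of [H0] at the conjugate is that of its twist at [P]. The twist only scales the
     coefficients by powers of [zeta i], so its value is a multiple of [m], which justifies the
     rounding. *)
  pose c2 (i' : 'I_m) (r' : 'I_(q + 1)) := (zeta i ^+ r')%:P * c i' r'.
  have sev p : s' (evv p) = evv p by rewrite -(ev2C iota v v) rmorph_ev2 // sv.
  have es : s' H0 = part c2 j.
    rewrite /H0 /part rmorph_sum; apply: eq_bigr => r' _.
    rewrite /= rmorphM rmorphXn /= sev sy -/(zeta i) exprMn /c2 rmorphM /= evC.
    by rewrite rmorphXn /=; ring.
  have p20 : part c2 j != 0 by rewrite -es fmorph_eq0.
  have [e Pe] := val_part_mul Pv Pt p20.
  have RH0 : R H0 = m%:Z * e by rewrite sR es.
  right; rewrite valM ?expf_neq0 // valX uD1 valV Rt opprK RH0.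
  have hga' : ga%:Z <= e + s%:Z.
    by apply: hga; move: hge; rewrite RH0 ej PoszM; clear; lia.
  rewrite PoszM mulrC -mulrDr ler_wpM2l // /B PoszD.
  by move: hA hga'; clear; lia.
have [T sT eT] := bu_reduce (ex_intro _ T0 eT0).
have H20 : H2 != 0 by apply: contraNneq H10; rewrite eH2 => ->; rewrite mulr0.
have Tn0 : T != 0 by apply: contraNneq H20; rewrite eT => ->; rewrite rmorph0.
have [i' [j' [hi' Tij' _ QH2 _]]] := val_ev2 b_neq0 u_neq0 Tn0 sT bu_indepQ.
have [i2 [j2 [_ _ _ PH2 Pmin]]] := val_ev2 b_neq0 u_neq0 Tn0 sT (bu_indep Pv Pt).
have QHH : Q H0 = Q H2.
  have := congr1 (fun f => Q f) eH2; rewrite /= !valM ?expf_neq0 // !valX uD1 valV Qt.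
  by rewrite oppr0 !mul0r addr0 add0r.
(* [u + 1] is a unit at [Q], so [H2] has the value of [H0] there. By distinctness of values the
   monomial [b ^ k0 * u ^ l] occurs in [T], and its presence bounds the value of [H2] at [P] from
   above. *)
have [ei' ej'] : i' = r /\ j' = k0.
  apply: (bu_indepQ hi'); first by rewrite -[q.+1]addn1.
  rewrite -QH2 -eT -QHH Qb Qu.
  move: QH; rewrite valM ?expf_neq0 // valX Qz mul1r Qs' Qz mul1r => h.
  by rewrite -addn1; move: h; rewrite !PoszD !PoszM; clear; lia.
have PH2le : P H2 <= P b * k0%:Z + P u * l%:Z.
  by rewrite eT PH2; apply: Pmin; rewrite -ej' -er -ei'.
have Pf : P f = P (zy_sum c) + s%:Z * m%:Z.
  rewrite ef valM ?invr_neq0 ?expf_neq0 // valV valX Pv'.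
  by rewrite mulNr opprK mulrC.
have zS0 : \sum_(j < m) z ^+ j * ev2 iota b u (S j) != 0.
  by rewrite -eS mulf_neq0 ?expf_neq0.
(* At [P] parts with different exponents of [z] have different values and cannot cancel, so the sum
   has at most the value of its [z ^ be] part. *)
have [_ /(_ j)] := val_zbu Pv Pt (fun j => (hS j).1) zS0.
rewrite -eSj => /(_ H10); rewrite -eS eH2 !valM ?mulf_neq0 ?expf_neq0 //.
rewrite !valX uD1 valV Pt' Pz ej => hP.
rewrite Pb Pu in PH2le.
have eq2 : (q ^ 2 - q)%N%:Z = q%:Z * q%:Z - q%:Z.
  by move: q_gt1; clear; nia.
rewrite eq2 in hP *.
rewrite PoszD [(m * _)%N%:Z]PoszM [(q + 1)%N%:Z]PoszD.
apply: (@tau_arith _ _ _ _ (P H2) k s%:Z A%:Z B%:Z ga%:Z l%:Z be%:Z k0%:Z _ ek Pf).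
- by rewrite /B PoszD; move: hA; clear; lia.
- by move: hP; rewrite !PoszM; clear; lia.
- by move: PH2le; rewrite !PoszM -addn1 PoszD; clear; lia.
Qed.

End Curve.

(** [be / M] and [be k / m] have the same ceiling: they differ by [be / (M m)], which is less than
    [1 / M] because [be < m]. The second ratio is the one that regularity at infinity produces. *)
Lemma ceil_ratio_bounds (m M k be : nat) (g : int) :
  m = (M * k + 1)%N -> (0 < M)%N -> (be < m)%N ->
  g = Num.ceil (be%:R / M%:R : rat) ->
  [/\ 0 <= g, (be * k)%N%:Z <= g * m%:Z &
      forall a : int, (be * k)%N%:Z <= m%:Z * a -> g <= a].
Proof.
move=> em M0 hbe eg.
have M0' : 0 < M%:R :> rat by rewrite ltr0n.
have gP a : (g <= a) = (be%:Z <= a * M%:Z).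
  rewrite eg ceil_le_int ler_pdivrMr //.
  by rewrite -(ler_int rat) intrM.
have g1 : be%:Z <= g * M%:Z by rewrite -gP.
have g0 : 0 <= g by move: g1 M0; clear; nia.
split=> // [|a ha].
  rewrite PoszM em PoszD PoszM; move: g1 g0; clear; nia.
rewrite gP leNgt; apply/negP => hlt.
have a0 : 0 <= a by move: ha; rewrite em; clear; nia.
have ka : k%:Z <= a by move: ha hlt a0; rewrite em; clear; nia.
by move: hlt ka hbe M0; rewrite em; clear; nia.
Qed.

(** * From the coordinates of the two points to the theorem *)

Lemma centered_over_x1 (K L : fieldType) (iota : {rmorphism K -> L}) (x y z : L)
    (R : place iota) :
  x != 1 -> centered_at x y z R 1 0 0 1 -> 0 < R (x - 1).
Proof.
move=> x1 [t t0 [/vanishesE hx _ _ ht]].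
have [_ Rt] := residue_val0 ht (oner_neq0 _); move: ht => /vanishesE ht.
have v0 : x - 1 != 0 by rewrite subr_eq0.
have e : t * (x - 1) = (t * x - iota 1) - (t - iota 1) by ring.
have := val_geB hx ht; rewrite -e.
by move/(val_geE (mulf_neq0 t0 v0)); rewrite valM // Rt; lia.
Qed.

(** The scaling [t] has a zero because the last coordinate vanishes, and [x] has the opposite value.
    The residues [1] and [-1] of [t x] and [t y] cancel in the sum, so [x + y] has a greater value
    than [x]. *)
Lemma centered_at_infinity (K L : fieldType) (iota : {rmorphism K -> L}) (x y z : L)
    (R : place iota) :
  x + y != 0 -> x != 1 -> centered_at x y z R 1 (-1) 0 0 ->
  R (x - 1) < 0 /\ R (x - 1) < R (x + y).
Proof.
move=> xy0 x1 [t t0 [hx /vanishesE hy _ /residue0P/(val_geE t0) Rt]].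
have [tx0 Rtx] := residue_val0 hx (oner_neq0 _); move: hx => /vanishesE hx.
have x0 : x != 0 by apply: contraNneq tx0 => ->; rewrite mulr0.
rewrite valM // in Rtx.
have [_ Rv] : x + -1 != 0 /\ R (x + -1) = R x.
  by apply: val_addl => //; right; rewrite valN val_one; lia.
have e : t * (x + y) = (t * x - iota 1) + (t * y - iota (- 1)) by ring.
have := val_geD hx hy; rewrite -e.
by move/(val_geE (mulf_neq0 t0 xy0)); rewrite valM // Rv; split; lia.
Qed.

Theorem theorem3p5 (q n : nat) (hq : prime_power q) (hn3 : (3 <= n)%N)
    (hn : odd n)
    (K : finFieldType) (hK : #|K| = (q ^ (2 * n))%N)
    (L : fieldType) (iota : {rmorphism K -> L}) (x y z : L)
    (hL : BM_function_field q n iota x y z)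
    (P1 Q1 : place iota)
    (hP1 : centered_at x y z P1 1 (-1) 0 0)
    (hQ1 : centered_at x y z Q1 1 0 0 1)
    (i k l b : int)
    (hi : i = - k * (q ^ n + 1)%N%:Z - l * (BM_m q n)%:Z - b)
    (hb : 0 <= b < (BM_m q n)%:Z)
    (hl : 0 <= l < (q + 1)%N%:Z) :
  let g : int := Num.ceil (b%:~R / (BM_M q n)%:R : rat) in
  is_tau Q1 P1 i
    (k * (q ^ n + 1)%N%:Z + (g + l) * (BM_m q n)%:Z * q%:Z
     + b * (q ^ 2 - q)%N%:Z).
Proof.
have q1 := prime_power_gt1 hq; have [mN mM M0'] := BM_mE q1 hn.
have M0 := M0' hn3; move: (BM_m q n) (BM_M q n) (BM_cover hL) mN mM M0 hi hb {M0'}.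
move=> m M z_eq mN mM M0 hi hb g.
have n0 : (0 < n)%N by apply: leq_trans hn3.
have q_char := pnat_finField_pchar hq hK.
have [w w_prim] := primitive_root_exists q1 n0 hK; rewrite -mN in w_prim hi *.
pose v := x - 1; have xE : x = v + 1 by rewrite subrK.
have y_eq := BM_hermitian hL; have L_gen := BM_generated hL.
have x1 : x != 1.
  have X1 : 'X - 1 != 0 :> {poly K} by rewrite -polyC1 polyXsubC_eq0.
  by have := BM_transcendental hL X1; rewrite rmorphB rmorph1 /= map_polyX !hornerE subr_eq0.
have xy0 : x + y != 0.
  rewrite addr_eq0; apply/eqP => e; move: y_eq; rewrite e !addn1 !exprSr.
  rewrite (exprNq q_char iota q1) mulrNN => /eqP.
  by rewrite -subr_eq0 opprB addrC subrK oner_eq0.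
have Qv := centered_over_x1 x1 hQ1.
have [Pv Pt] := centered_at_infinity xy0 x1 hP1.
rewrite -/v in Qv Pv Pt; rewrite xE in y_eq z_eq L_gen Pt.
case: b hb hi @g => // be hb hi g; case: l hl hi => // l hl hi.
have [g0 g1 g2] : [/\ _, _ & _] := ceil_ratio_bounds (g := g) mM M0 hb erefl.
case: g g0 g1 g2 => // ga _ g1 g2.
have eb : (be * (q ^ 2 - q) <= ga * m)%N by rewrite -lez_nat PoszM.
have ei : i = - (k * (m * (q + 1))%N%:Z + l%:Z * m%:Z + be%:Z) by rewrite hi; ring.
split=> [|j [f [hf f0 Qf Pf]]].
  rewrite ei -PoszD.
  exact: (tau_upper_bound q1 mM q_char w_prim y_eq z_eq L_gen Qv Pv Pt k l eb).
rewrite -[j]opprK -Pf lerNr -PoszD.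
apply: (tau_lower_bound q1 mM q_char w_prim y_eq z_eq L_gen Qv Pv Pt hl hb g2 hf f0).
by rewrite Qf ei opprK.
Qed.
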